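(* Let $(X,0)$ be a germ of complex spaces with distinguished point $0$ such that $\dim_{\mathbb{C}} T^1_{(X,0)} < +\infty$, and let $G$ be a compact complex Lie group acting holomorphically on $(X,0)$. Let $(S,0)$ denote the base of the $G$-equivariant semi-universal deformation of $(X,0)$ and $(S^G,0)$ its subgerm fixed by $G$. Then there exists a semi-universal deformation $\pi: (\mathcal{X},0) \rightarrow (S^G,0)$ of the pair $((X,0),G)$ such that $T_0S^G\cong (T^1_{(X,0)})^G$.
   Context: A deformation of $(X,0)$ over a germ $(S,0)$ is a flat morphism of germs of complex spaces $\pi:(\mathcal{X},0)\to(S,0)$ with an identification of $(X,0)$ with $(\pi^{-1}(0),0)$. $T^1_{(X,0)}$ is the $\mathbb{C}$-vector space of isomorphism classes of deformations over the double point $\mathrm{Spec}(\mathbb{C}[\epsilon])$, $\epsilon^2=0$; $G$ acts naturally and linearly on it (an element $g$ acts by changing the identification $\iota$ of $(X,0)$ with the central fibre to $\iota\circ g^{-1}$), and $(T^1_{(X,0)})^G$ is the subspace of invariants. A deformation is semi-universal if every deformation $\rho:(\mathcal{Y},0)\to(T,0)$ of $(X,0)$ is isomorphic to its pullback by some morphism $\phi:(T,0)\to(S,0)$ whose differential is unique. A $G$-equivariant deformation of $(X,0)$ is a deformation $\pi:(\mathcal{X},0)\to(S,0)$ with $G$-actions on $(\mathcal{X},0)$ and $(S,0)$ such that $\pi$ is equivariant and the action on $(\mathcal{X},0)$ extends the given one on $(X,0)$. It is $G$-equivariantly semi-universal if it is semi-universal and every $G$-equivariant deformation $\rho:(\mathcal{Y},0)\to(T,0)$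 is $G$-equivariantly isomorphic to the pullback of $\pi$ by a $G$-equivariant morphism $\phi:(T,0)\to(S,0)$ whose differential is unique. Under the hypotheses of the claim such a deformation exists and is unique up to $G$-equivariant isomorphism. A deformation of the pair $((X,0),G)$ over $(S,0)$ is a deformation $\pi:(\mathcal{X},0)\to(S,0)$ of $(X,0)$ with a $G$-action on $(\mathcal{X},0)$ extending the given one on $(X,0)$, such that $\pi$ is equivariant for the trivial $G$-action on $(S,0)$. It is semi-universal if for every deformation $\rho:(\mathcal{Y},0)\to(T,0)$ of $((X,0),G)$ there is a morphism of germs $\phi:(T,0)\to(S,0)$, whose differential is unique, such that $\rho$ is $G$-equivariantly isomorphic to the pullback of $\pi$ along $\phi$. *)

(* Defs.v *)
(* Germs of complex spaces are handled through their local rings: a germ is a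
   closed subgerm of (C^n,0), given by an ideal of C{x_1,..,x_n}, its ring of
   functions is the quotient C{x}/I, and morphisms of germs are local
   C-algebra morphisms in the opposite direction. *)
From HB Require Import structures.
From mathcomp Require Import all_boot all_order all_algebra.
From mathcomp Require Import complex.
From mathcomp Require Import all_classical all_reals all_analysis.
(* The notations of mpoly conflict with those of analysis. *)
From mathcomp Require Import (canonicals) mpoly.

Set Implicit Arguments.
Unset Strict Implicit.
Unset Printing Implicit Defensive.

Import Order.TTheory GRing.Theory Num.Theory numFieldNormedType.Exports.
Local Open Scope classical_set_scope.
Local Open Scope ring_scope.
Local Open Scope quotient_scope.

Local Notation mnm := mpoly.multinom.
Local Notation mdeg := mpoly.mdeg.

Section Convergent.
Variables (R : realType) (n : nat).
Local Notation C := (R[i]).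

(* Partial sums of sum_k |a_k| r^|k|, the norm on the closed polydisc of radius r. *)
Definition pnorm (r : C) (a : mnm n -> C^o) (d : nat) : C :=
  \sum_(k : mpoly.bmultinom n d) `|a (mpoly.bmnm k)| * r ^+ mdeg (mpoly.bmnm k).

Definition convergent (a : mnm n -> C^o) : Prop :=
  exists r M : C, 0 < r /\ forall d, pnorm r a d <= M.

Definition cps_pred : {pred mnm n -> C^o} := fun a => `[< convergent a >].

Lemma pnorm_ge0 r a d : 0 < r -> 0 <= pnorm r a d.
Proof. by move=> /ltW r0; apply: sumr_ge0 => k _; rewrite mulr_ge0 ?exprn_ge0. Qed.

Lemma pnormW r r' a d : 0 < r -> r <= r' -> pnorm r a d <= pnorm r' a d.
Proof.
move=> r0 rr'; apply: ler_sum => k _; apply: ler_wpM2l => //.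
by apply: lerXn2r => //; rewrite nnegrE ltW // (lt_le_trans r0 rr').
Qed.

Lemma convergent2 a b : convergent a -> convergent b ->
  exists r M N : C, [/\ 0 < r, forall d, pnorm r a d <= M & forall d, pnorm r b d <= N].
Proof.
move=> [r [M [r0 aM]]] [s [N [s0 bN]]].
have [rs|/ltW sr] := real_leP (gtr0_real r0) (gtr0_real s0).
  by exists r, M, N; split=> // d; exact: le_trans (pnormW _ _ r0 rs) (bN d).
by exists s, M, N; split=> // d; exact: le_trans (pnormW _ _ s0 sr) (aM d).
Qed.

Fact cps_submod_closed : submod_closed cps_pred.
Proof.
split.
  apply/asboolP; exists 1, 0; split=> // d.
  by rewrite /pnorm big1 // => k _; rewrite normr0 mul0r.
move=> c a b /asboolP ca /asboolP cb; apply/asboolP.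
have [r [M [N [r0 aM bN]]]] := convergent2 ca cb.
exists r, (`|c| * M + N); split=> // d.
apply: le_trans (lerD (ler_wpM2l (normr_ge0 c) (aM d)) (bN d)).
rewrite /pnorm mulr_sumr -big_split /=; apply: ler_sum => k _.
rewrite mulrA -mulrDl; apply: ler_wpM2r; first by rewrite exprn_ge0 ?ltW.
by apply: le_trans (ler_normD _ _) _; rewrite normrM.
Qed.

HB.instance Definition _ :=
  GRing.isSubmodClosed.Build C (mnm n -> C^o) cps_pred cps_submod_closed.

(* C{x_1,..,x_n}: power series converging absolutely on some polydisc. *)
Record cps := CPS { coef :> mnm n -> C^o; _ : coef \in cps_pred }.

HB.instance Definition _ := [isSub for coef].
HB.instance Definition _ := [Choice of cps by <:].
HB.instance Definition _ := [SubChoice_isSubLmodule of cps by <:].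

Lemma cpsP (a b : cps) : (forall m, a m = b m) <-> a = b.
Proof. by split=> [ab|->//]; apply/val_inj/funext. Qed.

Lemma coefD (a b : cps) m : (a + b) m = a m + b m. Proof. by []. Qed.
Lemma coefZ c (a : cps) m : (c *: a) m = c * a m. Proof. by []. Qed.

Definition mulcoef (a b : mnm n -> C) (m : mnm n) : C :=
  \sum_(k : mpoly.bmultinom n (mdeg m).+1 * mpoly.bmultinom n (mdeg m).+1
        | m == mpoly.mnm_add (mpoly.bmnm k.1) (mpoly.bmnm k.2))
    a (mpoly.bmnm k.1) * b (mpoly.bmnm k.2).

Definition onecoef (m : mnm n) : C := (m == mpoly.mnm0)%:R.

Let tr d (a : mnm n -> C) : mpoly.mpoly n C :=
  \sum_(k : mpoly.bmultinom n d) (a (mpoly.bmnm k)) *: mpoly.mpolyX C (mpoly.bmnm k).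

Let trE d a m : (mdeg m < d)%N -> mpoly.mcoeff m (tr d a) = a m.
Proof. exact: mpoly.mcoeff_mpoly. Qed.

Let mulcoefEm (p q : mpoly.mpoly n C) a b (m : mnm n) :
  (forall k, (mdeg k <= mdeg m)%N -> mpoly.mcoeff k p = a k) ->
  (forall k, (mdeg k <= mdeg m)%N -> mpoly.mcoeff k q = b k) ->
  mulcoef a b m = mpoly.mcoeff m (p * q).
Proof.
move=> pa qb; rewrite mpoly.mcoeffM; apply: eq_bigr => -[k l] _ /=.
by rewrite pa ?qb // -ltnS; [case: l|case: k].
Qed.

Let mulcoefE d a b m : (mdeg m < d)%N ->
  mulcoef a b m = mpoly.mcoeff m (tr d a * tr d b).
Proof.
by move=> md; apply: mulcoefEm => k km; rewrite trE // (leq_ltn_trans km).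
Qed.

Lemma convergent_mul a b : convergent a -> convergent b -> convergent (mulcoef a b).
Proof.
move=> ca cb; have [r [M [N [r0 aM bN]]]] := convergent2 ca cb.
exists r, (M * N); split=> // d.
have r0' := ltW r0.
apply: le_trans (ler_pM (pnorm_ge0 _ _ r0) (pnorm_ge0 _ _ r0) (aM d) (bN d)).
rewrite /pnorm mulr_suml.
under [leRHS]eq_bigr do rewrite mulr_sumr.
rewrite pair_bigA /=.
pose F (p : mpoly.bmultinom n d * mpoly.bmultinom n d) (k : mpoly.bmultinom n d) :=
  mpoly.bmnm k == mpoly.mnm_add (mpoly.bmnm p.1) (mpoly.bmnm p.2).
have /le_trans -> // : \sum_(k : mpoly.bmultinom n d)
   `|mulcoef a b (mpoly.bmnm k)| * r ^+ mdeg (mpoly.bmnm k) <=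
   \sum_(k : mpoly.bmultinom n d)
     \sum_(p : mpoly.bmultinom n d * mpoly.bmultinom n d | F p k)
    (`|a (mpoly.bmnm p.1)| * r ^+ mdeg (mpoly.bmnm p.1)
     * (`|b (mpoly.bmnm p.2)| * r ^+ mdeg (mpoly.bmnm p.2))).
  apply: ler_sum => k _; rewrite (@mulcoefE d) ?mpoly.bmdeg //.
  rewrite (mpoly.mcoeff_poly_mul _ _ (k := d)) ?mpoly.bmdeg //.
  under eq_bigr do rewrite !trE ?mpoly.bmdeg //.
  apply: le_trans (ler_wpM2r (exprn_ge0 _ r0') (ler_norm_sum _ _ _)) _.
  rewrite mulr_suml; apply: ler_sum => -[p q] /eqP /= ->.
  by rewrite mpoly.mdegD exprD normrM mulrACA.
rewrite (exchange_big_dep xpredT) //=; apply: ler_sum => p _.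
have nn : 0 <= `|a (mpoly.bmnm p.1)| * r ^+ mdeg (mpoly.bmnm p.1)
     * (`|b (mpoly.bmnm p.2)| * r ^+ mdeg (mpoly.bmnm p.2)).
  by rewrite !mulr_ge0 ?exprn_ge0.
case: (pickP (F p)) => [k Fk|F0]; last by rewrite big_pred0.
rewrite (big_pred1 k) // => l; rewrite /F -(eqP Fk).
by apply/eqP/eqP => [/val_inj|->].
Qed.

Fact convergent_one : convergent onecoef.
Proof.
exists 1, 1; split=> // d; rewrite /pnorm.
case: d => [|d]; first by rewrite big1 // => -[].
rewrite (bigD1 mpoly.bm0) //= big1 ?addr0.
  by rewrite expr1n mulr1 /onecoef eqxx normr1.
move=> k k0; rewrite /onecoef; case: eqP => [e|]; last by rewrite normr0 mul0r.
by case/eqP: k0; apply/val_inj.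
Qed.

Definition cps_one : cps := CPS (asboolT convergent_one).

Fact cps_mul_subproof (a b : cps) : mulcoef a b \in cps_pred.
Proof. by apply/asboolP/convergent_mul; apply/asboolP; [case: a|case: b]. Qed.

Definition cps_mul (a b : cps) : cps := CPS (cps_mul_subproof a b).

Let mulE (a b : cps) d m : (mdeg m < d)%N ->
  cps_mul a b m = mpoly.mcoeff m (tr d a * tr d b).
Proof. exact: mulcoefE. Qed.

Fact cps_mulA : associative cps_mul.
Proof.
move=> a b c; apply/cpsP => m; pose d := (mdeg m).+1.
transitivity (mpoly.mcoeff m (tr d a * (tr d b * tr d c))).
  apply: mulcoefEm => k km; first by rewrite trE.
  exact/esym/mulE.
rewrite mulrA; apply/esym/mulcoefEm => k km; last by rewrite trE.
exact/esym/mulE.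
Qed.

Fact cps_mulC : commutative cps_mul.
Proof. by move=> a b; apply/cpsP => m; rewrite !(mulE _ _ (ltnSn _)) mulrC. Qed.

Fact cps_mul1 : left_id cps_one cps_mul.
Proof.
move=> a; apply/cpsP => m.
transitivity (mpoly.mcoeff m (1 * tr (mdeg m).+1 a)).
  by apply: mulcoefEm => k km; rewrite ?trE // mpoly.mcoeff1.
by rewrite mul1r trE.
Qed.

Fact cps_mulDl : left_distributive cps_mul +%R.
Proof.
move=> a b c; apply/cpsP => m; pose d := (mdeg m).+1.
rewrite coefD (mulE a c (ltnSn _)) (mulE b c (ltnSn _)) -mpoly.mcoeffD -mulrDl.
apply: mulcoefEm => k km; last by rewrite trE.
by rewrite mpoly.mcoeffD !trE.
Qed.

Fact cps_one_neq0 : cps_one != 0.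
Proof.
apply/eqP => /cpsP/(_ mpoly.mnm0); rewrite /= /onecoef eqxx => /eqP.
by rewrite oner_eq0.
Qed.

HB.instance Definition _ := GRing.Zmodule_isComNzRing.Build cps
  cps_mulA cps_mulC cps_mul1 cps_mulDl cps_one_neq0.

Fact cps_scaleAl (c : C) (a b : cps) : c *: (a * b) = c *: a * b.
Proof.
apply/cpsP => m; rewrite coefZ; rewrite /= /mulcoef mulr_sumr.
by apply: eq_bigr => k _; rewrite mulrA.
Qed.

HB.instance Definition _ := GRing.Lmodule_isLalgebra.Build C cps cps_scaleAl.
HB.instance Definition _ := GRing.Lalgebra_isComAlgebra.Build C cps.

Lemma coef1 m : (1 : cps) m = onecoef m. Proof. by []. Qed.

Lemma coefM (a b : cps) m : (a * b) m = mulcoef a b m. Proof. by []. Qed.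

Lemma coefM0 (a b : cps) : (a * b) mpoly.mnm0 = a mpoly.mnm0 * b mpoly.mnm0.
Proof.
rewrite coefM (mulcoefE _ _ (ltnSn _)).
rewrite -!(trE _ (ltnSn (mdeg mpoly.mnm0))).
exact: (rmorphM (mpoly.mcoeff mpoly.mnm0)).
Qed.

Fact coordcoef_convergent i : convergent (fun m => (m == mpoly.mnm1 i)%:R).
Proof.
exists 1, 1; split=> // d; rewrite /pnorm.
have le1 (k : mpoly.bmultinom n d) : mpoly.bmnm k != mpoly.mnm1 i ->
    `|(mpoly.bmnm k == mpoly.mnm1 i)%:R : C| * 1 ^+ mdeg (mpoly.bmnm k) = 0.
  by move=> /negPf ->; rewrite normr0 mul0r.
have [[k /eqP ki]|no] := pselect (exists k : mpoly.bmultinom n d, mpoly.bmnm k = mpoly.mnm1 i).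
  rewrite (bigD1 k) //= big1 ?addr0.
    by rewrite ki normr1 expr1n mulr1.
  move=> l lk; apply: le1; apply: contra lk => /eqP e.
  by apply/eqP/val_inj; rewrite /= e (eqP ki).
by rewrite big1 // => k _; apply: le1; apply/eqP => ki; apply: no; exists k.
Qed.

Definition coord (i : 'I_n) : cps := CPS (asboolT (coordcoef_convergent i)).

End Convergent.
Section IdealSpan.
Variable A : comNzRingType.

Definition ideal_span (E : set A) : set A :=
  [set x | exists (n : nat) (c e : 'I_n -> A),
     (forall i, E (e i)) /\ x = \sum_i c i * e i].

Lemma ideal_span0 E : ideal_span E 0.
Proof. by exists 0, (fun=> 0), (fun=> 0); split; [case|rewrite big_ord0]. Qed.

Lemma ideal_spanD E x y : ideal_span E x -> ideal_span E y -> ideal_span E (x + y).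
Proof.
move=> [n [c [e [Ee ->]]]] [m [d [f [Ef ->]]]].
pose glue (u : 'I_n -> A) (v : 'I_m -> A) (i : 'I_(n + m)) :=
  match fintype.split i with inl j => u j | inr j => v j end.
exists (n + m)%N, (glue c d), (glue e f); split.
  by move=> i; rewrite /glue; case: splitP.
rewrite big_split_ord /=; congr (_ + _); apply: eq_bigr => i _; rewrite /glue.
  by rewrite (unsplitK (inl i)).
by rewrite (unsplitK (inr i)).
Qed.

Lemma ideal_spanM E a x : ideal_span E x -> ideal_span E (a * x).
Proof.
move=> [n [c [e [Ee ->]]]]; exists n, (fun i => a * c i), e; split=> //.
by rewrite mulr_sumr; apply: eq_bigr => i _; rewrite mulrA.
Qed.

End IdealSpan.

Section Flat.
Variables (A B : comNzRingType) (phi : {rmorphism A -> B}).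

(* The element sum_i x_i (x) b_i of the tensor product over A of M and B
   vanishes. By the universal property of the tensor product this holds iff
   every A-balanced biadditive map kills the sum; this avoids building the
   tensor product as a quotient. *)
Definition tensor_eq0 (M : lmodType A) (s : seq (M * B)) : Prop :=
  forall (P : zmodType) (beta : M -> B -> P),
    (forall x y b, beta (x + y) b = beta x b + beta y b) ->
    (forall x b c, beta x (b + c) = beta x b + beta x c) ->
    (forall a x b, beta (a *: x) b = beta x (phi a * b)) ->
    \sum_(p <- s) beta p.1 p.2 = 0.

Definition flat : Prop :=
  forall (M N : lmodType A) (u : {linear M -> N}), injective u ->
  forall s : seq (M * B),
    tensor_eq0 [seq (u p.1, p.2) | p <- s] -> tensor_eq0 s.

End Flat.

Section GermDef.
Variable R : realType.
Local Notation C := (R[i]).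


(* [gideal_at0] says that the distinguished point 0 lies on the zero locus. The
   ring C{x} is noetherian, so finite generation of the ideal is automatic. *)
Record germ := Germ {
  gdim : nat;
  gideal : idealr (cps R gdim);
  gideal_at0 : forall a : cps R gdim, a \in gideal -> a mpoly.mnm0 = 0
}.

Definition gfun (X : germ) : Type := {ideal_quot (gideal X)}.

Section Gfun.
Variable X : germ.

HB.instance Definition _ := GRing.ComNzRing.on (gfun X).

Definition gclass (a : cps R (gdim X)) : gfun X := \pi_({ideal_quot (gideal X)}) a.

Definition grepr (f : gfun X) : cps R (gdim X) := repr (f : {ideal_quot (gideal X)}).

Lemma greprK f : gclass (grepr f) = f. Proof. exact: reprK. Qed.

Lemma gclass_eq a b : gclass a = gclass b <-> a - b \in gideal X.
Proof. by rewrite Quotient.idealrBE; split=> [/eqP|/eqP]. Qed.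

Lemma gclassD a b : gclass (a + b) = gclass a + gclass b.
Proof. exact: (rmorphD \pi_({ideal_quot (gideal X)})). Qed.

Lemma gclassM a b : gclass (a * b) = gclass a * gclass b.
Proof. exact: (rmorphM \pi_({ideal_quot (gideal X)})). Qed.

Definition gscale (c : C) (f : gfun X) : gfun X := gclass (c *: grepr f).

Lemma gclassZ c a : gscale c (gclass a) = gclass (c *: a).
Proof.
apply/gclass_eq; rewrite -scalerBr -mulr_algl; apply: idealMr.
by apply/gclass_eq; rewrite greprK.
Qed.

Fact gscaleA c d f : gscale c (gscale d f) = gscale (c * d) f.
Proof. by rewrite -[f]greprK !gclassZ scalerA. Qed.
Fact gscale1 : left_id 1 gscale.
Proof. by move=> f; rewrite -[f]greprK gclassZ scale1r. Qed.
Fact gscaleDr : right_distributive gscale +%R.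
Proof. by move=> c f g; rewrite -[f]greprK -[g]greprK -gclassD !gclassZ scalerDr gclassD. Qed.
Fact gscaleDl f : {morph gscale^~ f : c d / c + d}.
Proof. by move=> c d; rewrite -[f]greprK !gclassZ scalerDl gclassD. Qed.

HB.instance Definition _ :=
  GRing.Zmodule_isLmodule.Build C (gfun X) gscaleA gscale1 gscaleDr gscaleDl.

Fact gscaleAl (c : C) (f g : gfun X) : c *: (f * g) = c *: f * g.
Proof.
rewrite -[f]greprK -[g]greprK -gclassM.
by rewrite [LHS]gclassZ [c *: gclass _]gclassZ -gclassM scalerAl.
Qed.

HB.instance Definition _ := GRing.Lmodule_isLalgebra.Build C (gfun X) gscaleAl.
HB.instance Definition _ := GRing.Lalgebra_isComAlgebra.Build C (gfun X).

(* The value of f at the distinguished point. *)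
Definition gval (f : gfun X) : C := grepr f mpoly.mnm0.

Lemma gval_class a : gval (gclass a) = a mpoly.mnm0.
Proof.
have /gideal_at0 : grepr (gclass a) - a \in gideal X by apply/gclass_eq; rewrite greprK.
by move=> /eqP; rewrite subr_eq0 => /eqP.
Qed.

Lemma gvalD f g : gval (f + g) = gval f + gval g.
Proof. by rewrite -[f]greprK -[g]greprK -gclassD !gval_class. Qed.

Lemma gvalZ c f : gval (c *: f) = c * gval f.
Proof. by rewrite -[f]greprK [c *: _]gclassZ !gval_class. Qed.

Lemma gval1 : gval 1 = 1.
Proof.
have <- : gclass 1 = 1 :> gfun X by exact: (rmorph1 \pi_({ideal_quot (gideal X)})).
by rewrite gval_class coef1 /onecoef eqxx.
Qed.

Definition gmax : set (gfun X) := [set f | gval f = 0].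

End Gfun.

(* A morphism X -> Y, given by the pull-back of functions. *)
Record mor (X Y : germ) := Mor {
  pull :> {lrmorphism gfun Y -> gfun X};
  pull_local : forall f, gmax f -> gmax (pull f)
}.

Lemma gval_pull X Y (phi : mor X Y) f : gval (phi f) = gval f.
Proof.
have : gmax (f - (gval f)%:A).
  by rewrite /gmax /= gvalD -scaleNr gvalZ gval1 mulr1 subrr.
move=> /(pull_local phi); rewrite /gmax /= linearB linearZ /= rmorph1.
by rewrite gvalD -scaleNr gvalZ gval1 mulr1 => /eqP; rewrite subr_eq0 => /eqP.
Qed.

Fact mor_id_local X : forall f : gfun X, gmax f -> gmax (idfun f).
Proof. by []. Qed.

Definition mor_id X : mor X X := Mor (pull := idfun) (@mor_id_local X).

End GermDef.

Section GermConstructions.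
Variable R : realType.
Local Notation C := (R[i]).

Section Generated.
Variables (n : nat) (E : set (cps R n)).
Hypothesis E0 : forall a : cps R n, E a -> a mpoly.mnm0 = 0.

Definition gen_pred of (forall a : cps R n, E a -> a mpoly.mnm0 = 0) : {pred cps R n} :=
  fun a => `[< ideal_span E a >].

Lemma ideal_span_at0 a : ideal_span E a -> a mpoly.mnm0 = 0.
Proof.
move=> [k [c [e [Ee ->]]]]; elim/big_ind : _ => // [x y x0 y0|i _].
  by rewrite coefD x0 y0 addr0.
by rewrite coefM0 (E0 (Ee i)) mulr0.
Qed.

Fact gen_idealr_closed : idealr_closed (gen_pred E0).
Proof.
split; first exact/asboolP/ideal_span0.
  apply/asboolP => /ideal_span_at0; rewrite coef1 /onecoef eqxx => /eqP.
  by rewrite oner_eq0.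
move=> a u v /asboolP Eu /asboolP Ev; apply/asboolP/ideal_spanD => //.
exact: ideal_spanM.
Qed.

HB.instance Definition _ := isIdealr.Build (cps R n) (gen_pred E0) gen_idealr_closed.

Fact gen_at0 a : a \in gen_pred E0 -> a mpoly.mnm0 = 0.
Proof. by move=> /asboolP/ideal_span_at0. Qed.

Definition germ_of_gens : germ R := Germ gen_at0.

End Generated.

(* Spec C[e_1,..,e_k]/(e_1,..,e_k)^2, presented as C{x}/(x_i x_j). *)
Definition square_gens k : set (cps R k) :=
  [set a | exists i j : 'I_k, a = coord R i * coord R j].

Fact square_gens_at0 k a : @square_gens k a -> a mpoly.mnm0 = 0.
Proof.
move=> [i [j ->]]; rewrite coefM0 /= [_ == _](_ : _ = false) ?mul0r //.
by apply/eqP => /(congr1 (@mdeg k)); rewrite mpoly.mdeg0 mpoly.mdeg1.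
Qed.

Definition fat_point k : germ R := germ_of_gens (@square_gens_at0 k).

Definition eps k (i : 'I_k) : gfun (fat_point k) := gclass (X := fat_point k) (coord R i).

Definition double_point : germ R := fat_point 1.
End GermConstructions.

Section Tangent.
Variable R : realType.
Local Notation C := (R[i]).

Section TangentSpace.
Variable X : germ R.

(* The Zariski tangent space T_0 X: point derivations at 0 of the local ring. *)
Definition derivation_at0 (v : gfun X -> C^o) : Prop :=
  [/\ forall f g, v (f + g) = v f + v g,
      forall c f, v (c *: f) = c * v f &
      forall f g, v (f * g) = gval f * v g + gval g * v f].

Definition der_pred : {pred gfun X -> C^o} := fun v => `[< derivation_at0 v >].

Fact der_submod_closed : submod_closed der_pred.
Proof.
split.
  by apply/asboolP; split=> [f g|c f|f g]; rewrite /= ?mulr0 ?addr0.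
move=> c v w /asboolP[vD vZ vM] /asboolP[wD wZ wM]; apply/asboolP.
have E f : (c *: v + w) f = c * v f + w f by [].
split=> [f g|d f|f g]; rewrite !E ?vD ?wD ?vZ ?wZ ?vM ?wM.
- by rewrite mulrDr addrACA.
- by rewrite mulrDr mulrCA.
by rewrite !mulrDr (mulrCA c (gval f)) (mulrCA c (gval g)) addrACA.
Qed.

HB.instance Definition _ :=
  GRing.isSubmodClosed.Build C (gfun X -> C^o) der_pred der_submod_closed.

Record tangent := Tangent { tanv :> gfun X -> C^o; _ : tanv \in der_pred }.

HB.instance Definition _ := [isSub for tanv].
HB.instance Definition _ := [Choice of tangent by <:].
HB.instance Definition _ := [SubChoice_isSubLmodule of tangent by <:].

End TangentSpace.

Fact differential_subproof X Y (phi : mor X Y) (v : tangent X) :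
  (v \o phi : gfun Y -> C^o) \in @der_pred Y.
Proof.
have /asboolP[vD vZ vM] : tanv v \in @der_pred X by case: v.
apply/asboolP; split=> [f g|c f|f g] /=.
- by rewrite rmorphD vD.
- by rewrite linearZ vZ.
by rewrite rmorphM vM !gval_pull.
Qed.

Definition differential X Y (phi : mor X Y) (v : tangent X) : tangent Y :=
  Tangent (differential_subproof phi v).

Definition same_differential X Y (phi psi : mor X Y) : Prop :=
  forall v : tangent X, differential phi v = differential psi v.

End Tangent.

Section Deformations.
Variable R : realType.
Local Notation C := (R[i]).

(* The identification of X with the central fibre is recorded as the closed
   embedding [inclusion] of X in the total space whose ideal is generated by the
   pull-back of the maximal ideal of the base, i.e. the ideal of the fibre. *)
Record deformation (X S : germ R) := Deformation {
  total_space : germ R;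
  projection : mor total_space S;
  projection_flat : flat projection;
  inclusion : mor X total_space;
  inclusion_surj : forall f, exists F, inclusion F = f;
  inclusion_ker : forall F, inclusion F = 0 <-> ideal_span (projection @` @gmax R S) F
}.

(* Y is the fibre product of X and T over S in the category of germs:
        Y --Phi--> X
       rho         pi
        T --phi--> S   *)
Definition cartesian (Y T X S : germ R)
    (Phi : mor Y X) (rho : mor Y T) (phi : mor T S) (pi : mor X S) : Prop :=
  (forall f, Phi (pi f) = rho (phi f)) /\
  forall (Z : germ R) (a : mor Z X) (b : mor Z T),
    (forall f, a (pi f) = b (phi f)) ->
    exists c : mor Z Y,
      [/\ forall f, c (Phi f) = a f, forall f, c (rho f) = b f &
          forall c' : mor Z Y, (forall f, c' (Phi f) = a f) ->
            (forall f, c' (rho f) = b f) -> forall f, c' f = c f].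

(* rho is isomorphic, as a deformation of X, to the pull-back of pi along phi. *)
Definition pullback_via (X T S : germ R) (rho : deformation X T) (phi : mor T S)
    (pi : deformation X S) (Phi : mor (total_space rho) (total_space pi)) : Prop :=
  cartesian Phi (projection rho) phi (projection pi) /\
  forall F, inclusion rho (Phi F) = inclusion pi F.

Arguments pullback_via {X T S} rho phi pi Phi.

Definition is_pullback (X T S : germ R) (rho : deformation X T) (phi : mor T S)
    (pi : deformation X S) : Prop :=
  exists Phi, pullback_via rho phi pi Phi.

Definition semiuniversal (X S : germ R) (pi : deformation X S) : Prop :=
  forall (T : germ R) (rho : deformation X T),
    exists phi : mor T S, is_pullback rho phi pi /\
      forall psi : mor T S, is_pullback rho psi pi -> same_differential psi phi.

Definition deformation_iso (X S : germ R) (xi eta : deformation X S) : Prop :=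
  exists Phi : mor (total_space xi) (total_space eta),
    [/\ bijective Phi, forall f, Phi (projection eta f) = projection xi f &
        forall F, inclusion xi (Phi F) = inclusion eta F].

Section T1.
Variable X : germ R.

(* Isomorphism classes are represented as subsets of the type of deformations. *)
Definition T1 : Type :=
  {c : deformation X (double_point R) -> Prop | exists xi, c = deformation_iso xi}.

Definition T1_class (xi : deformation X (double_point R)) : T1 :=
  exist _ (deformation_iso xi) (ex_intro _ xi erefl).

(* Vector space structure of T^1: x + y = z when some deformation over
   Spec C[e1,e2]/(e1,e2)^2 restricts to x on e2 = 0 (h1), to y on e1 = 0 (h2) and
   to z on the diagonal (h3); c x is the pull-back of x along e |-> c e. A morphism
   between fat points is determined by the images of the e_i. Both are stated as
   relations, which are graphs of operations by Schlessinger's condition for the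
   deformation functor of a germ. *)
Definition T1_add (x y z : T1) : Prop :=
  exists (zeta : deformation X (fat_point R 2))
         (h1 h2 h3 : mor (double_point R) (fat_point R 2))
         (xi eta sigma : deformation X (double_point R)),
    [/\ h1 (eps R ord0) = eps R ord0 /\ h1 (eps R ord_max) = 0,
        h2 (eps R ord0) = 0 /\ h2 (eps R ord_max) = eps R ord0,
        h3 (eps R ord0) = eps R ord0 /\ h3 (eps R ord_max) = eps R ord0,
        [/\ is_pullback xi h1 zeta, is_pullback eta h2 zeta & is_pullback sigma h3 zeta] &
        [/\ x = T1_class xi, y = T1_class eta & z = T1_class sigma]].

Definition T1_scale (c : C) (x y : T1) : Prop :=
  exists (h : mor (double_point R) (double_point R))
         (xi eta : deformation X (double_point R)),
    [/\ h (eps R ord0) = c *: eps R ord0, is_pullback eta h xi,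
        x = T1_class xi & y = T1_class eta].

Definition T1_linear (V : lmodType C) (theta : V -> T1) : Prop :=
  (forall v w, T1_add (theta v) (theta w) (theta (v + w))) /\
  (forall c v, T1_scale c (theta v) (theta (c *: v))).

Definition T1_finite_dim : Prop :=
  exists (n : nat) (theta : 'rV[C]_n -> T1), T1_linear theta /\ bijective theta.

End T1.
End Deformations.

Arguments pullback_via {R X T S} rho phi pi Phi.
Arguments T1_finite_dim {R} X.

#[short(type="topGroupType")]
HB.structure Definition TopGroup := {G of Group G & Topological G}.

Section LieGroup.
Variable R : realType.
Local Notation C := (R[i]).

Definition affine_space (d : nat) : normedModType C := 'rV[C]_d.

Record chart (G : topologicalType) (d : nat) := Chart {
  cdom : set G;
  cmap : G -> affine_space d;
  cinv : affine_space d -> G;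
  cdom_open : open cdom;
  cimg_open : open (cmap @` cdom);
  cmapK : forall x, cdom x -> cinv (cmap x) = x;
  cmap_continuous : forall x, cdom x -> {for x, continuous cmap};
  cinv_continuous : forall x, cdom x -> {for cmap x, continuous cinv}
}.

(* Second countability is not required: it follows from compactness in the
   statement. All components of a Lie group have the same dimension; dimension 0
   is allowed, so that finite groups are included. *)
Record complexLieGroup := ComplexLieGroup {
  lie_sort :> topGroupType;
  lie_dim : nat;
  lie_atlas : set (chart lie_sort lie_dim);
  lie_hausdorff : hausdorff_space lie_sort;
  lie_cover : forall x : lie_sort, exists2 c, lie_atlas c & cdom c x;
  lie_compat : forall c c', lie_atlas c -> lie_atlas c' ->
    forall x, cdom c x -> cdom c' x -> differentiable (cmap c' \o cinv c) (cmap c x);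
  lie_mul_continuous : continuous (fun p : lie_sort * lie_sort => (p.1 * p.2)%g);
  lie_mul_holomorphic : forall c c' c'', lie_atlas c -> lie_atlas c' -> lie_atlas c'' ->
    forall x y, cdom c x -> cdom c' y -> cdom c'' (x * y)%g ->
    differentiable
      (fun p : affine_space lie_dim * affine_space lie_dim => cmap c'' (cinv c p.1 * cinv c' p.2)%g)
      (cmap c x, cmap c' y);
  lie_inv_continuous : continuous (fun x : lie_sort => x^-1%g);
  lie_inv_holomorphic : forall c c', lie_atlas c -> lie_atlas c' ->
    forall x, cdom c x -> cdom c' x^-1%g ->
    differentiable (fun u : affine_space lie_dim => cmap c' (cinv c u)^-1%g) (cmap c x)
}.

Definition holomorphic_on (G : complexLieGroup) (U : set G) (h : G -> C) : Prop :=
  forall c x, @lie_atlas G c -> cdom c x -> U x ->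
    differentiable (h \o cinv c : affine_space (lie_dim G) -> C^o) (cmap c x).

(* A left action of G on the germ X fixing the distinguished point; [act g] pulls
   functions back along g, hence the order reversal in [actM]. Holomorphy of
   G x X -> X along G x {0}: near each g0, the pull-back of a function f is
   represented by a holomorphic function on U x (polydisc), that is, by a power
   series in x with coefficients holomorphic on U which converges on a fixed
   polydisc uniformly in g. *)
Record action (G : complexLieGroup) (X : germ R) := Action {
  act :> G -> mor X X;
  act1 : forall f, act 1%g f = f;
  actM : forall g h f, act (g * h)%g f = act h (act g f);
  act_holomorphic : forall (f : gfun X) (g0 : G),
    exists (U : set G) (a : G -> cps R (gdim X)),
      [/\ open U, U g0, forall g, U g -> act g f = gclass (a g),
          forall m : mnm (gdim X), holomorphic_on U (fun g => a g m) &
          exists r M : C, 0 < r /\ forall g d, U g -> pnorm r (a g) d <= M]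
}.

Section TrivialAction.
Variables (G : complexLieGroup) (S : germ R).

Fact trivial_act_holomorphic (f : gfun S) (g0 : G) :
  exists (U : set G) (a : G -> cps R (gdim S)),
    [/\ open U, U g0, forall g, U g -> mor_id S f = gclass (a g),
        forall m : mnm (gdim S), holomorphic_on U (fun g => a g m) &
        exists r M : C, 0 < r /\ forall g d, U g -> pnorm r (a g) d <= M].
Proof.
exists setT, (fun=> grepr f); split=> //.
- exact: openT.
- by move=> g _; rewrite greprK.
- by move=> m c x _ _ _; exact: differentiable_cst.
case: (grepr f) => a /= /asboolP[r [M [r0 aM]]].
by exists r, M; split.
Qed.

Definition trivial_action : action G S :=
  @Action G S (fun=> mor_id S) (fun=> erefl) (fun _ _ _ => erefl) trivial_act_holomorphic.

End TrivialAction.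

Section FixedGerm.
Variables (G : complexLieGroup) (S : germ R) (aS : action G S).

(* The largest closed subgerm of S on which G acts trivially. *)
Definition fixed_gens : set (cps R (gdim S)) :=
  [set a | a \in gideal S \/ exists g f, gclass a = aS g f - f].

Fact fixed_gens_at0 a : fixed_gens a -> a mpoly.mnm0 = 0.
Proof.
move=> [/gideal_at0 //|[g [f e]]].
by rewrite -gval_class e -scaleN1r gvalD gvalZ gval_pull mulN1r subrr.
Qed.

Definition fixed_germ : germ R := germ_of_gens fixed_gens_at0.

End FixedGerm.

Section Equivariant.
Variables (G : complexLieGroup) (X : germ R) (aX : action G X).

Record equivariant_deformation (S : germ R) (aS : action G S) := EquivariantDeformation {
  underlying_def :> deformation X S;
  total_action : action G (total_space underlying_def);
  projection_equivariant : forall g f,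
    total_action g (projection underlying_def f) = projection underlying_def (aS g f);
  inclusion_equivariant : forall g F,
    inclusion underlying_def (total_action g F) = aX g (inclusion underlying_def F)
}.

Definition equivariant (Y Z : germ R) (aY : action G Y) (aZ : action G Z)
    (phi : mor Y Z) : Prop :=
  forall g f, phi (aZ g f) = aY g (phi f).

Definition is_equivariant_pullback (T S : germ R) (aT : action G T) (aS : action G S)
    (rho : equivariant_deformation aT) (phi : mor T S)
    (pi : equivariant_deformation aS) : Prop :=
  exists2 Phi, pullback_via rho phi pi Phi & equivariant (total_action rho) (total_action pi) Phi.

Definition equivariantly_semiuniversal (S : germ R) (aS : action G S)
    (pi : equivariant_deformation aS) : Prop :=
  semiuniversal pi /\
  forall (T : germ R) (aT : action G T) (rho : equivariant_deformation aT),
    exists phi : mor T S,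
      [/\ equivariant aT aS phi, is_equivariant_pullback rho phi pi &
          forall psi : mor T S, equivariant aT aS psi ->
            is_equivariant_pullback rho psi pi -> same_differential psi phi].

(* Deformations of the pair (X, G). *)
Definition pair_deformation (S : germ R) : Type :=
  equivariant_deformation (trivial_action G S).

Definition pair_semiuniversal (S : germ R) (pi : pair_deformation S) : Prop :=
  forall (T : germ R) (rho : pair_deformation T),
    exists phi : mor T S, is_equivariant_pullback rho phi pi /\
      forall psi : mor T S, is_equivariant_pullback rho psi pi ->
        same_differential psi phi.

Section Twist.
Variables (S : germ R) (g : G) (xi : deformation X S).

Let twist_map : {lrmorphism gfun (total_space xi) -> gfun X} := aX g^-1%g \o inclusion xi.

Fact twist_local f : gmax f -> gmax (twist_map f).
Proof. by move=> f0; do 2 apply: pull_local. Qed.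

(* The action of g on deformations: the identification is precomposed with g^-1. *)
Definition twist_incl : mor X (total_space xi) := Mor twist_local.

Lemma actVK f : aX g (aX g^-1%g f) = f.
Proof. by rewrite -actM mulVg act1. Qed.

Lemma actKV f : aX g^-1%g (aX g f) = f.
Proof. by rewrite -actM mulgV act1. Qed.

Fact twist_surj f : exists F, twist_incl F = f.
Proof. by have [F e] := inclusion_surj xi (aX g f); exists F; rewrite /= e actKV. Qed.

Fact twist_ker F : twist_incl F = 0 <-> ideal_span (projection xi @` @gmax R S) F.
Proof.
rewrite -inclusion_ker; split=> /= [|->]; last by rewrite rmorph0.
by move=> /(congr1 (aX g)); rewrite actVK rmorph0.
Qed.

Definition twist : deformation X S :=
  Deformation (@projection_flat _ _ _ xi) twist_surj twist_ker.

End Twist.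

Definition T1_invariant (x : T1 X) : Prop :=
  forall g xi, x = T1_class xi -> T1_class (twist g xi) = x.

End Equivariant.
End LieGroup.

(* Main.v *)
(* The functor of deformations of (X, G) over T consists of the equivariant deformations over T
   with trivial action, hence it is represented, up to the usual ambiguity, by morphisms T -> S
   that are invariant under G, i.e. that factor through S^G: the restriction of the equivariant
   semi-universal deformation to S^G is semi-universal for the pair.
   The tangent space is the Kodaira-Spencer map w |-> [w^* eta] of S, which is injective by
   uniqueness of the differential of the classifying map. Twisting the pull-back along
   phi : D -> S by g gives the pull-back along g o phi, so that the class of phi^* eta is
   invariant iff phi has the same differential as g o phi for all g, which for the double point
   D means that phi itself is invariant.
   Only two kinds of base change have to be constructed: along a closed embedding, where flatness
   passes to the quotient, and along S x F -> S for a fat point F, where the total space is free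
   over the old one; the pull-back along F -> S is obtained from them through the graph. *)
Require Import Defs.
From HB Require Import structures.
From mathcomp Require Import all_boot all_order all_algebra.
From mathcomp Require Import complex.
From mathcomp Require Import all_classical all_reals all_analysis.
From mathcomp Require Import (canonicals, coercions) mpoly.

Set Implicit Arguments.
Unset Strict Implicit.
Unset Printing Implicit Defensive.

Import Order.TTheory GRing.Theory Num.Theory numFieldNormedType.Exports.
Local Open Scope classical_set_scope.
Local Open Scope ring_scope.
Local Open Scope quotient_scope.

Local Notation coord := Defs.coord.
Local Notation mnm := mpoly.multinom.
Local Notation mdeg := mpoly.mdeg.
Local Notation mnmD := mpoly.mnm_add.
Local Notation U_ := mpoly.mnm1.

(** * Generated ideals *)

Lemma ideal_span_gen (A : comNzRingType) (E : set A) x : E x -> ideal_span E x.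
Proof.
by move=> Ex; exists 1%N, (fun=> 1), (fun=> x); split=> //; rewrite big_ord1 mul1r.
Qed.

Lemma ideal_span_sum (A : comNzRingType) (E : set A) n (F : 'I_n -> A) :
  (forall i, ideal_span E (F i)) -> ideal_span E (\sum_i F i).
Proof.
move=> EF; elim/big_ind : _ => // [|x y]; first exact: ideal_span0.
exact: ideal_spanD.
Qed.

Lemma ideal_span_morph (A B : comNzRingType) (h : {rmorphism A -> B})
    (E : set A) (E' : set B) x :
  (forall e, E e -> ideal_span E' (h e)) -> ideal_span E x -> ideal_span E' (h x).
Proof.
move=> EE' [n [c [e [Ee ->]]]]; rewrite rmorph_sum.
by apply: ideal_span_sum => i; rewrite rmorphM; apply/ideal_spanM/EE'.
Qed.

Lemma ideal_span_ker (A B : comNzRingType) (h : {rmorphism A -> B}) (E : set A) x :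
  (forall e, E e -> h e = 0) -> ideal_span E x -> h x = 0.
Proof.
move=> E0 [n [c [e [Ee ->]]]]; rewrite rmorph_sum big1 // => i _.
by rewrite rmorphM (E0 (e i)) ?mulr0.
Qed.

(** * Base change of flat morphisms *)

Section RestrictScalars.
Variables (A A' : comNzRingType).

(** The carrier is unchanged; the morphism is a phantom argument, so that the type determines the
    A-module structure. *)
Definition restrict_scalars of {rmorphism A -> A'} : lmodType A' -> Type := id.

Variable i : {rmorphism A -> A'}.

Section Lmodule.
Variable M : lmodType A'.
HB.instance Definition _ := GRing.Zmodule.on (restrict_scalars i M).

Let scale a (x : restrict_scalars i M) : restrict_scalars i M := i a *: (x : M).

Fact restrict_scalarsA a b x : scale a (scale b x) = scale (a * b) x.
Proof. by rewrite /scale scalerA rmorphM. Qed.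
Fact restrict_scalars1 : left_id 1 scale.
Proof. by move=> x; rewrite /scale rmorph1 scale1r. Qed.
Fact restrict_scalarsDr : right_distributive scale +%R.
Proof. by move=> a x y; exact: scalerDr. Qed.
Fact restrict_scalarsDl x : {morph scale^~ x : a b / a + b}.
Proof. by move=> a b; rewrite /scale rmorphD; exact: scalerDl. Qed.

HB.instance Definition _ := GRing.Zmodule_isLmodule.Build A (restrict_scalars i M)
  restrict_scalarsA restrict_scalars1 restrict_scalarsDr restrict_scalarsDl.
End Lmodule.

Section Linear.
Variables (M N : lmodType A') (u : {linear M -> N}).

Definition restrict_map (x : restrict_scalars i M) : restrict_scalars i N := u x.

Fact restrict_map_linear : linear restrict_map.
Proof. by move=> a x y; exact: (linearP u (i a) x y). Qed.

HB.instance Definition _ := GRing.isLinear.Build A (restrict_scalars i M)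
  (restrict_scalars i N) _ restrict_map restrict_map_linear.
End Linear.
End RestrictScalars.

Section FlatBaseChange.
Variables (A B A' B' : comNzRingType) (phi : {rmorphism A -> B}) (i : {rmorphism A -> A'})
  (j : {rmorphism B -> B'}) (phi' : {rmorphism A' -> B'}).
Hypothesis square : forall a, j (phi a) = phi' (i a).
Hypothesis generated : forall b', exists s : seq (A' * B), b' = \sum_(p <- s) phi' p.1 * j p.2.
(* Together with [generated], this says that B' is the tensor product of A' and B over A. *)
Hypothesis extension : forall (M : lmodType A') (P : zmodType) (beta : M -> B -> P),
  (forall x y b, beta (x + y) b = beta x b + beta y b) ->
  (forall x b c, beta x (b + c) = beta x b + beta x c) ->
  (forall a x b, beta (i a *: x) b = beta x (phi a * b)) ->
  exists beta' : M -> B' -> P,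
  [/\ forall x y b, beta' (x + y) b = beta' x b + beta' y b,
      forall x b c, beta' x (b + c) = beta' x b + beta' x c,
      forall a x b, beta' (a *: x) b = beta' x (phi' a * b) &
      forall x b, beta' x (j b) = beta x b].

(** The expansions given by [generated] turn a tensor of M and B' over A' into one of M and B over
    A, with the same values under balanced maps and compatibly with u. By [extension], a tensor that
    vanishes over A' still vanishes over A once spread out, so flatness of [phi] applies to u seen
    as an A-linear map. *)
Lemma flat_base_change : flat phi -> flat phi'.
Proof.
move=> fphi M N u uinj s us0.
have [gen genE] := choice generated.
(* The tensor of x and b' becomes the sum of the tensors of a' x and b, over the terms phi'(a') j(b)
   of the chosen expansion of b'. *)
pose spread (L : lmodType A') (t : seq (L * B')) : seq (L * B) :=
  flatten [seq [seq (q.1 *: p.1, q.2) | q <- gen p.2] | p <- t].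
have spreadE (L : lmodType A') (P : zmodType) (beta' : L -> B' -> P) t :
    (forall x b c, beta' x (b + c) = beta' x b + beta' x c) ->
    (forall a x b, beta' (a *: x) b = beta' x (phi' a * b)) ->
    \sum_(p <- spread L t) beta' p.1 (j p.2) = \sum_(p <- t) beta' p.1 p.2.
  move=> bD bZ; have b0 x : beta' x 0 = 0.
    by apply: (addIr (beta' x 0)); rewrite -bD !add0r.
  rewrite big_flatten big_map; apply: eq_bigr => p _.
  rewrite big_map [p.2 in RHS]genE (big_morph (beta' p.1) (bD p.1) (b0 p.1)).
  by apply: eq_bigr => q _; rewrite bZ.
have spread_map : spread N [seq (u p.1, p.2) | p <- s]
    = [seq (u p.1, p.2) | p <- spread M s].
  rewrite /spread map_flatten -!map_comp; congr flatten; apply: eq_map => p /=.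
  by rewrite -map_comp; apply: eq_map => q /=; rewrite linearZ.
pose uA : {linear restrict_scalars i M -> restrict_scalars i N} := @restrict_map A A' i M N u.
have flat_spread := fphi _ _ uA uinj (spread M s).
move=> P beta bD1 bD2 bZ; rewrite -spreadE //.
apply: (flat_spread _ P (fun x b => beta x (j b))) => [Q gamma gD1 gD2 gZ|||].
- have [gamma' [gD1' gD2' gZ' gE]] := @extension N Q gamma gD1 gD2 gZ.
  rewrite -[RHS](us0 Q gamma') // -spreadE // spread_map !big_map.
  by apply: eq_bigr => p _; rewrite /= gE.
- by move=> x y b; rewrite bD1.
- by move=> x b c; rewrite rmorphD bD2.
- by move=> a x b; rewrite rmorphM square; exact: bZ.
Qed.

End FlatBaseChange.

(** * Morphisms of germs and closed subgerms *)

Section Morphisms.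
Variable R : realType.
Local Notation C := (R[i]).
Implicit Types X Y Z : germ R.

Section MakeMor.
Variables (X Y : germ R) (h : gfun Y -> gfun X).
Hypotheses (hD : {morph h : f g / f + g}) (hZ : forall c f, h (c *: f) = c *: h f)
  (hM : {morph h : f g / f * g}) (h1 : h 1 = 1) (hval : forall f, gval (h f) = gval f).

Let h_linear : linear h. Proof. by move=> c f g; rewrite hD hZ. Qed.

Let h_lrmorphism : {lrmorphism gfun Y -> gfun X} := HB.pack h
  (GRing.isLinear.Build C (gfun Y) (gfun X) _ h h_linear)
  (GRing.isMonoidMorphism.Build (gfun Y) (gfun X) h (conj h1 hM)).

Let h_local f : gmax f -> gmax (h_lrmorphism f).
Proof. by rewrite /gmax /= hval. Qed.

Definition make_mor : mor X Y := Mor h_local.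

End MakeMor.

Definition mor_comp X Y Z (psi : mor Y Z) (phi : mor X Y) : mor X Z :=
  Mor (pull := phi \o psi) (fun f f0 => pull_local phi (pull_local psi f0)).

(** Surjectivity of [q] on functions makes Y a closed subgerm of X. [phi'] is computed on a chosen
    lift, and two lifts differ by an element that [phi] kills. *)
Lemma mor_factor X Y Z (q : mor Y X) (phi : mor Z X) :
  (forall g, exists f, q f = g) -> (forall f, q f = 0 -> phi f = 0) ->
  exists phi' : mor Z Y, forall f, phi' (q f) = phi f.
Proof.
move=> /choice[lift liftK] kerq; pose h g := phi (lift g).
have hq f : h (q f) = phi f.
  have : phi (lift (q f) - f) = 0 by apply: kerq; rewrite rmorphB /= liftK subrr.
  by rewrite rmorphB => /eqP; rewrite subr_eq0 => /eqP.
have hD : {morph h : f g / f + g}.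
  by move=> f g; rewrite -[f]liftK -[g]liftK -rmorphD !hq rmorphD.
have hZ c f : h (c *: f) = c *: h f by rewrite -[f]liftK -linearZ !hq linearZ.
have hM : {morph h : f g / f * g}.
  by move=> f g; rewrite -[f]liftK -[g]liftK -rmorphM !hq rmorphM.
have h1 : h 1 = 1 by rewrite -(rmorph1 q) hq rmorph1.
have hval f : gval (h f) = gval f by rewrite -[f]liftK hq !gval_pull.
by exists (make_mor hD hZ hM h1 hval).
Qed.

Lemma gvalM X (f g : gfun X) : gval (f * g) = gval f * gval g.
Proof. by rewrite -[f]greprK -[g]greprK -gclassM !gval_class coefM0. Qed.

Lemma gval0 X : gval (0 : gfun X) = 0.
Proof. by rewrite -(scale0r 0) gvalZ mul0r. Qed.

Lemma gval_sum X I (r : seq I) (P : pred I) (F : I -> gfun X) :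
  gval (\sum_(i <- r | P i) F i) = \sum_(i <- r | P i) gval (F i).
Proof. exact: (big_morph (@gval R X) (@gvalD R X) (gval0 X)). Qed.

(** The residue field C is reduced. This puts prescribed square-zero functions in the maximal
    ideal. *)
Lemma gval_sq0 Z (z : gfun Z) : z * z = 0 -> gval z = 0.
Proof.
by move=> /(congr1 (@gval R Z)); rewrite gvalM gval0 => /eqP; rewrite mulf_eq0 orbb => /eqP.
Qed.

Lemma gclass1 X : gclass 1 = 1 :> gfun X.
Proof. exact: (rmorph1 \pi_({ideal_quot (gideal X)})). Qed.

Fact gclass_zmod_morphism X : zmod_morphism (@gclass R X).
Proof. exact: (rmorphB \pi_({ideal_quot (gideal X)})). Qed.

HB.instance Definition _ X := GRing.isZmodMorphism.Build (cps R (gdim X)) (gfun X)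
  (@gclass R X) (@gclass_zmod_morphism X).
HB.instance Definition _ X := GRing.isMonoidMorphism.Build (cps R (gdim X)) (gfun X)
  (@gclass R X) (conj (gclass1 X) (@gclassM R X)).

Lemma gclass_eq0 X (a : cps R (gdim X)) : gclass a = 0 <-> a \in gideal X.
Proof.
by rewrite -(rmorph0 (@gclass R X)) gclass_eq subr0.
Qed.

End Morphisms.

Section Subgerm.
Variables (R : realType) (X : germ R) (J : set (gfun X)).

(* For J = {g f - f} these are definitionally the generators of the fixed germ. *)
Definition subgerm_gens : set (cps R (gdim X)) :=
  [set a | a \in gideal X \/ J (gclass a)].

Hypothesis J0 : forall a, subgerm_gens a -> a mpoly.mnm0 = 0.

Definition subgerm : germ R := germ_of_gens J0.

Let incl (f : gfun X) : gfun subgerm := gclass (X := subgerm) (grepr f).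

Let inclE a : incl (gclass a) = gclass (X := subgerm) a.
Proof.
apply/gclass_eq/asboolP/ideal_span_gen; left.
by apply/gclass_eq; rewrite greprK.
Qed.

Definition subgerm_incl : mor subgerm X.
Proof.
apply: (@make_mor R subgerm X incl) => [f g|c f|f g||f].
- by rewrite -[f]greprK -[g]greprK -gclassD !inclE -gclassD.
- rewrite -[f]greprK inclE; apply: etrans (congr1 incl (gclassZ c _)) _.
  by rewrite inclE; exact/esym/(gclassZ (X := subgerm)).
- by rewrite -[f]greprK -[g]greprK -gclassM !inclE -gclassM.
- by rewrite -(gclass1 X) inclE; exact: (gclass1 subgerm).
by rewrite -[f]greprK inclE !gval_class.
Defined.

Lemma subgerm_inclE a : subgerm_incl (gclass a) = gclass (X := subgerm) a.
Proof. exact: inclE. Qed.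

Lemma subgerm_incl_surj f : exists F, subgerm_incl F = f.
Proof. by exists (gclass (X := X) (grepr f)); rewrite subgerm_inclE greprK. Qed.

(** The generators lying in [gideal X] become zero among the functions of X, which leaves
    combinations of elements of J. *)
Lemma subgerm_incl_ker f : subgerm_incl f = 0 <-> ideal_span J f.
Proof.
split; last first.
  apply: ideal_span_ker => e Je.
  have := subgerm_inclE (grepr e); rewrite greprK => eE; apply: etrans eE _.
  apply/(gclass_eq0 (X := subgerm))/asboolP; apply: ideal_span_gen; right.
  by rewrite greprK.
rewrite -[f]greprK subgerm_inclE => /gclass_eq0/asboolP.
apply: (ideal_span_morph (h := @gclass R X)) => e /=.
move=> [/gclass_eq0 e0|]; last exact: ideal_span_gen.
by rewrite e0; exact: ideal_span0.
Qed.

End Subgerm.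

(** * Pull-backs of deformations *)

Section Pullbacks.
Variable R : realType.
Implicit Types X S T Y Z : germ R.

(** X lies over the point 0 of the base: f - f(0) is in the maximal ideal, whose pull-back generates
    the ideal of X. *)
Lemma inclusion_projection X S (pi : deformation X S) f :
  inclusion pi (projection pi f) = (gval f)%:A.
Proof.
have f0 : gmax (f - (gval f)%:A).
  by rewrite /gmax /= gvalD -scaleNr gvalZ gval1 mulr1 subrr.
have : inclusion pi (projection pi (f - (gval f)%:A)) = 0.
  by apply/inclusion_ker/ideal_span_gen; exists (f - (gval f)%:A).
rewrite linearB linearZ /= rmorph1 linearB linearZ /= rmorph1 => /eqP.
by rewrite subr_eq0 => /eqP.
Qed.

Lemma cartesian_uniq (Y T X S Z : germ R) (Phi : mor Y X) (rho : mor Y T) (phi : mor T S)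
    (pi : mor X S) (c c' : mor Z Y) : cartesian Phi rho phi pi ->
  (forall f, c (Phi f) = c' (Phi f)) -> (forall f, c (rho f) = c' (rho f)) ->
  forall f, c f = c' f.
Proof.
move=> [sq univ] cPhi crho f.
have [|d [_ _ duniq]] := univ Z (mor_comp Phi c) (mor_comp rho c).
  by move=> g /=; rewrite sq.
by rewrite (duniq c) // (duniq c') // => g; rewrite -?cPhi -?crho.
Qed.

(** Pasting of cartesian squares: a cone over the large square factors first through [zeta], then
    through [rho]. *)
Lemma pullback_comp X (S T U : germ R) (pi : deformation X S) (zeta : deformation X T)
    (rho : deformation X U) (phi : mor T S) (psi : mor U T) Phi Psi :
  pullback_via zeta phi pi Phi -> pullback_via rho psi zeta Psi ->
  pullback_via rho (mor_comp phi psi) pi (mor_comp Phi Psi).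
Proof.
move=> [[sq univ] incPhi] [[sq' univ'] incPsi]; split; last first.
  by move=> F /=; rewrite incPsi incPhi.
split=> [f /=|Z a b ab]; first by rewrite sq sq'.
have [c [cPhi czeta cuniq]] := univ Z a (mor_comp psi b) ab.
have [d [dPsi drho duniq]] := univ' Z c b czeta.
exists d; split=> // [f /=|d' d'Phi d'rho f]; first by rewrite dPsi.
apply: duniq => // g; apply: (cuniq (mor_comp Psi d')) => //= h.
by rewrite sq' d'rho.
Qed.

(** [Psi] comes from the universal property of the square of [Phi]. It respects the inclusions by
    uniqueness in that square: functions from the base T restrict on X to their values at 0 on both
    sides. *)
Lemma pullback_cancel X (S T U : germ R) (pi : deformation X S) (zeta : deformation X T)
    (rho : deformation X U) (phi : mor T S) (psi : mor U T) Phi Chi :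
  pullback_via zeta phi pi Phi -> pullback_via rho (mor_comp phi psi) pi Chi ->
  exists2 Psi, pullback_via rho psi zeta Psi & forall F, Psi (Phi F) = Chi F.
Proof.
move=> [cart incPhi] [[sq' univ'] incChi]; have [sq univ] := cart.
have [Psi [PsiPhi Psizeta _]] := univ _ Chi (mor_comp psi (projection rho)) sq'.
exists Psi => //; split; last first.
  apply: (cartesian_uniq (c := mor_comp Psi (inclusion rho)) cart) => f /=.
    by rewrite PsiPhi incChi incPhi.
  by rewrite Psizeta /= !inclusion_projection gval_pull.
split=> [f|Z a b ab]; first by rewrite Psizeta.
have [f|c [cChi crho cuniq]] := univ' Z (mor_comp Phi a) b; first by rewrite /= sq ab.
exists c; split=> // [|c' c'Psi c'rho]; last first.
  by apply: cuniq => // f /=; rewrite -PsiPhi c'Psi.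
apply: (cartesian_uniq (c := mor_comp Psi c) cart) => f /=.
  by rewrite PsiPhi cChi.
by rewrite Psizeta /= crho ab.
Qed.

Lemma eq_pullback_via X S T (pi : deformation X S) (rho : deformation X T) (phi psi : mor T S)
    Phi : (forall f, phi f = psi f) -> pullback_via rho phi pi Phi -> pullback_via rho psi pi Phi.
Proof.
move=> e [[sq univ] inc]; split=> //; split=> [f|Z a b ab]; first by rewrite -e sq.
by apply: univ => f; rewrite ab e.
Qed.

Lemma eq_is_pullback X S T (pi : deformation X S) (rho : deformation X T) (phi psi : mor T S) :
  (forall f, phi f = psi f) -> is_pullback rho phi pi -> is_pullback rho psi pi.
Proof. by move=> e [Phi hPhi]; exists Phi; exact: eq_pullback_via hPhi. Qed.

Lemma is_pullback_comp X (S T U : germ R) (pi : deformation X S) (zeta : deformation X T)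
    (rho : deformation X U) (phi : mor T S) (psi : mor U T) (chi : mor U S) :
  (forall f, psi (phi f) = chi f) ->
  is_pullback zeta phi pi -> is_pullback rho psi zeta -> is_pullback rho chi pi.
Proof.
move=> e [Phi hPhi] [Psi hPsi]; apply: (eq_is_pullback (phi := mor_comp phi psi)) => //.
by exists (mor_comp Phi Psi); exact: pullback_comp.
Qed.

Lemma is_pullback_cancel X (S T U : germ R) (pi : deformation X S) (zeta : deformation X T)
    (rho : deformation X U) (phi : mor T S) (psi : mor U T) (chi : mor U S) :
  (forall f, psi (phi f) = chi f) ->
  is_pullback zeta phi pi -> is_pullback rho chi pi -> is_pullback rho psi zeta.
Proof.
move=> e [Phi hPhi] rhochi.
have [Chi hChi] := eq_is_pullback (psi := mor_comp phi psi) (fun f => esym (e f)) rhochi.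
by have [Psi hPsi _] := pullback_cancel hPhi hChi; exists Psi.
Qed.

(** Writing [phi] as [phi] after the identity and cancelling gives morphisms over T in both
    directions; uniqueness in the cartesian squares makes them mutually inverse. *)
Lemma is_pullback_iso X S T (pi : deformation X S) (phi : mor T S) (xi eta : deformation X T) :
  is_pullback xi phi pi -> is_pullback eta phi pi -> deformation_iso xi eta.
Proof.
move=> [Phi hPhi] [Psi hPsi].
have hPhi1 : pullback_via xi (mor_comp phi (mor_id T)) pi Phi := hPhi.
have hPsi1 : pullback_via eta (mor_comp phi (mor_id T)) pi Psi := hPsi.
have [u [ucart uinc] uE] := pullback_cancel hPsi hPhi1.
have [v [vcart vinc] vE] := pullback_cancel hPhi hPsi1.
exists u; split=> //; last by case: ucart.
exists v => f.
  apply: (cartesian_uniq (c := mor_comp u v) (c' := mor_id _) hPsi.1) => g /=.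
    by rewrite uE vE.
  by case: ucart => -> _; case: vcart => ->.
apply: (cartesian_uniq (c := mor_comp v u) (c' := mor_id _) hPhi.1) => g /=.
  by rewrite vE uE.
by case: vcart => -> _; case: ucart => ->.
Qed.

(** Together with [is_pullback_iso] this treats isomorphisms as pull-backs along the identity, so
    that symmetry and transitivity follow from the calculus of pull-backs. *)
Lemma deformation_iso_pullback X S (xi eta : deformation X S) :
  deformation_iso xi eta -> is_pullback xi (mor_id S) eta.
Proof.
move=> [Phi [[inv Phi1 Phi2] sq inc]]; exists Phi; split=> //; split=> // Z a b ab.
have Phi_surj g : exists f, Phi f = g by exists (inv g).
have [f Pf0|c cE] := mor_factor (phi := a) Phi_surj.
  by rewrite -(Phi1 f) Pf0 -(rmorph0 Phi) Phi1 rmorph0.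
exists c; split=> // [f|c' c'Phi _ f]; first by rewrite -sq cE ab.
by rewrite -(Phi2 f) c'Phi cE.
Qed.

Lemma is_pullback_isol X S T (pi : deformation X S) (phi : mor T S) (xi eta : deformation X T) :
  deformation_iso xi eta -> is_pullback eta phi pi -> is_pullback xi phi pi.
Proof.
by move=> /deformation_iso_pullback xieta etapi; exact: is_pullback_comp etapi xieta.
Qed.

Lemma deformation_iso_refl X S (xi : deformation X S) : deformation_iso xi xi.
Proof. by exists (mor_id _); split=> //; exists id. Qed.

Lemma deformation_iso_sym X S (xi eta : deformation X S) :
  deformation_iso xi eta -> deformation_iso eta xi.
Proof.
move=> /deformation_iso_pullback; apply: is_pullback_iso.
exact/deformation_iso_pullback/deformation_iso_refl.
Qed.

Lemma deformation_iso_trans X S (xi eta zeta : deformation X S) :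
  deformation_iso xi eta -> deformation_iso eta zeta -> deformation_iso xi zeta.
Proof.
move=> xieta /deformation_iso_pullback etazeta.
apply: (is_pullback_iso (is_pullback_isol xieta etazeta)).
exact/deformation_iso_pullback/deformation_iso_refl.
Qed.

Lemma T1_class_eq X (xi eta : deformation X (double_point R)) :
  T1_class xi = T1_class eta <-> deformation_iso xi eta.
Proof.
split=> [/(congr1 sval) /= ->|xieta]; first exact: deformation_iso_refl.
apply: eq_exist; apply/funext => zeta; apply/propext; split.
  exact/deformation_iso_trans/deformation_iso_sym.
exact: deformation_iso_trans.
Qed.

Lemma T1_classP X (x : T1 X) : exists xi, x = T1_class xi.
Proof.
by case: x => c [xi e]; exists xi; exact: eq_exist.
Qed.

End Pullbacks.

(** * Restriction to a closed subgerm *)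

Section ClosedBaseChange.
Variables (R : realType) (X S T : germ R) (pi : deformation X S) (i : mor T S).
Hypothesis i_surj : forall t, exists s, i s = t.
Variables (E : germ R) (q : mor E (total_space pi)).
Hypothesis q_surj : forall F', exists F, q F = F'.
Hypothesis q_ker : forall F,
  q F = 0 <-> ideal_span (projection pi @` [set f | i f = 0]) F.

Fact closed_projection_ex : exists p : mor E T, forall f, p (i f) = q (projection pi f).
Proof.
apply: (mor_factor (phi := mor_comp (projection pi) q) i_surj) => f f0.
by apply/q_ker/ideal_span_gen; exists f.
Qed.

Definition closed_projection : mor E T := sval (cid closed_projection_ex).

Lemma closed_projectionE f : closed_projection (i f) = q (projection pi f).
Proof. exact: (svalP (cid closed_projection_ex)). Qed.

(** A function in the ideal of T vanishes at 0, so its pull-back to the total space vanishes on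
    X. *)
Fact closed_inclusion_ex : exists j : mor X E, forall F, j (q F) = inclusion pi F.
Proof.
apply: (mor_factor q_surj) => F /q_ker; apply: ideal_span_ker => _ [f f0 <-] /=.
by rewrite inclusion_projection -(gval_pull i) f0 gval0 scale0r.
Qed.

Definition closed_inclusion : mor X E := sval (cid closed_inclusion_ex).

Lemma closed_inclusionE F : closed_inclusion (q F) = inclusion pi F.
Proof. exact: (svalP (cid closed_inclusion_ex)). Qed.

Lemma closed_inclusion_surj f : exists F, closed_inclusion F = f.
Proof.
by have [F <-] := inclusion_surj pi f; exists (q F); rewrite closed_inclusionE.
Qed.

Lemma closed_inclusion_ker F :
  closed_inclusion F = 0 <-> ideal_span (closed_projection @` @gmax R T) F.
Proof.
split; last first.
  apply: ideal_span_ker => _ [t t0 <-] /=; have [f ft] := i_surj t.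
  rewrite -ft closed_projectionE closed_inclusionE inclusion_projection.
  by move: t0; rewrite /gmax /= -ft gval_pull => ->; rewrite scale0r.
have [F' <-] := q_surj F; rewrite closed_inclusionE => /inclusion_ker.
apply: (ideal_span_morph (h := q)) => _ [f f0 <-]; apply: ideal_span_gen.
by exists (i f); [exact: pull_local|rewrite closed_projectionE].
Qed.

(** The functions of E are those of the total space modulo the ideal generated by the ideal of T,
    that is, their tensor product with the functions of T. A balanced map on a module over the
    functions of T kills this ideal, so it may be evaluated on arbitrary lifts. *)
Lemma closed_projection_flat : flat closed_projection.
Proof.
apply: (flat_base_change (j := q) (i := i) _ _ _ (@projection_flat _ _ _ pi)).
- by move=> f; exact/esym/closed_projectionE.
- move=> b; have [F <-] := q_surj b; exists [:: (1, F)].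
  by rewrite big_seq1 /= rmorph1 mul1r.
move=> M P beta bD1 bD2 bZ; have [lift liftK] := choice q_surj.
have b0 x : beta x 0 = 0 by apply: (addIr (beta x 0)); rewrite -bD2 !add0r.
have b0l b : beta 0 b = 0 by apply: (addIr (beta 0 b)); rewrite -bD1 !add0r.
have ker0 x b : q b = 0 -> beta x b = 0.
  move=> /q_ker[n [c [e [/= eJ ->]]]]; rewrite (big_morph (beta x) (bD2 x) (b0 x)).
  rewrite big1 // => l _; have [f f0 <-] := eJ l.
  (* Balancedness moves f to the module side, where it acts as [i f = 0]. *)
  by rewrite mulrC -bZ [X in X *: _]f0 scale0r b0l.
have qeq x b c : q b = q c -> beta x b = beta x c.
  move=> bc; rewrite -[b](subrK c) bD2 ker0 ?add0r //.
  by rewrite rmorphB /= bc subrr.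
exists (fun x b => beta x (lift b)); split=> [x y b|x b c|a x b|x b].
- exact: bD1.
- by rewrite -bD2; apply: qeq; rewrite rmorphD /= !liftK.
- have [f <-] := i_surj a; rewrite bZ; apply: qeq.
  rewrite rmorphM /= !liftK; congr (_ * _); exact/esym/closed_projectionE.
by apply: qeq; rewrite liftK.
Qed.

(** The total space is a parameter, so that the deformation can be put on a germ already known to
    carry an action. *)
Definition closed_pullback : deformation X T :=
  Deformation closed_projection_flat closed_inclusion_surj closed_inclusion_ker.

Lemma closed_pullback_via : pullback_via closed_pullback i pi q.
Proof.
split; last exact: closed_inclusionE.
split=> [f|Z a b ab]; first by rewrite /= closed_projectionE.
have [F /q_ker|c cE] := mor_factor (phi := a) q_surj.
  by apply: ideal_span_ker => _ [f f0 <-] /=; rewrite ab f0 rmorph0.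
exists c; split=> // [t|c' c'q _ F].
  by have [f <-] := i_surj t; rewrite /= closed_projectionE cE ab.
by have [F' <-] := q_surj F; rewrite c'q cE.
Qed.

End ClosedBaseChange.

Lemma closed_pullback_exists (R : realType) (X S T : germ R) (pi : deformation X S)
    (i : mor T S) : (forall t, exists s, i s = t) ->
  exists rho : deformation X T, is_pullback rho i pi.
Proof.
move=> i_surj; pose J : set (gfun (total_space pi)) := projection pi @` [set f | i f = 0].
have J0 (a : cps R (gdim (total_space pi))) : subgerm_gens J a -> a mpoly.mnm0 = 0.
  move=> [/gideal_at0//|[f f0 fa]].
  by rewrite -gval_class -fa gval_pull -(gval_pull i) f0 gval0.
exists (closed_pullback i_surj (@subgerm_incl_surj _ _ _ J0) (@subgerm_incl_ker _ _ _ J0)).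
exists (subgerm_incl J0); exact: closed_pullback_via.
Qed.

(** Stability of J makes each [aX g] descend. Holomorphy is inherited because the power series that
    represent the action on a lift also represent it on the subgerm. *)
Lemma subgerm_action (R : realType) (G : complexLieGroup R) (X : germ R) (aX : action G X)
    (J : set (gfun X)) (J0 : forall a, subgerm_gens J a -> a mpoly.mnm0 = 0) :
  (forall g f, J f -> ideal_span J (aX g f)) ->
  exists aY : action G (subgerm J0),
    forall g f, aY g (subgerm_incl J0 f) = subgerm_incl J0 (aX g f).
Proof.
move=> Jstable; pose q := subgerm_incl J0.
have ex g : exists phi : mor (subgerm J0) (subgerm J0), forall f, phi (q f) = q (aX g f).
  apply: (mor_factor (phi := mor_comp (aX g) q) (@subgerm_incl_surj _ _ _ J0)) => f.
  move=> /subgerm_incl_ker Jf; apply/subgerm_incl_ker.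
  by apply: ideal_span_morph Jf => e; exact: Jstable.
have [act actE] := choice ex.
have act1' f : act 1%g f = f.
  by have [F <-] := @subgerm_incl_surj _ _ _ J0 f; rewrite actE act1.
have actM' g h f : act (g * h)%g f = act h (act g f).
  by have [F <-] := @subgerm_incl_surj _ _ _ J0 f; rewrite !actE actM.
have act_hol (f : gfun (subgerm J0)) (g0 : G) :
    exists (U : set G) (a : G -> cps R (gdim (subgerm J0))),
      [/\ open U, U g0, forall g, U g -> act g f = gclass (a g),
          forall m : mpoly.multinom (gdim (subgerm J0)), holomorphic_on U (fun g => a g m) &
          exists r M : R[i], 0 < r /\ forall g d, U g -> pnorm r (a g) d <= M].
  have [F <-] := subgerm_incl_surj f.
  have [U [a [oU Ug0 aE ahol abound]]] := act_holomorphic aX F g0.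
  exists U, a; split=> // g Ug; rewrite actE aE //.
  exact: subgerm_inclE.
by exists (Action act1' actM' act_hol).
Qed.

(** * Convergent power series and fat points *)

Section MulCoef.
Variable R : realType.
Local Notation C := (R[i]).

Lemma eq_mulcoef n (a a' b b' : mnm n -> C) m :
  (forall k l, m = mnmD k l -> a k = a' k) -> (forall k l, m = mnmD k l -> b l = b' l) ->
  mulcoef a b m = mulcoef a' b' m.
Proof. by move=> aa' bb'; apply: eq_bigr => -[k l] /eqP /= e; rewrite (aa' _ _ e) (bb' _ _ e). Qed.

Lemma mcoeff_mulcoef n (p q : mpoly.mpoly n C) m :
  mpoly.mcoeff m (p * q) = mulcoef (fun k => mpoly.mcoeff k p) (fun k => mpoly.mcoeff k q) m.
Proof. exact: mpoly.mcoeffM. Qed.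

Definition truncation n d (a : mnm n -> C) : mpoly.mpoly n C :=
  \sum_(k : mpoly.bmultinom n d) (a (mpoly.bmnm k)) *: mpoly.mpolyX C (mpoly.bmnm k).

Lemma mcoeff_truncation n d (a : mnm n -> C) m :
  (mdeg m < d)%N -> mpoly.mcoeff m (truncation d a) = a m.
Proof. exact: mpoly.mcoeff_mpoly. Qed.

(** A coefficient of a product involves only coefficients of no larger degree, so coefficient
    identities can be verified on polynomials. *)
Lemma mulcoef_truncation n d (a b : mnm n -> C) m : (mdeg m < d)%N ->
  mulcoef a b m = mpoly.mcoeff m (truncation d a * truncation d b).
Proof.
move=> md; rewrite mcoeff_mulcoef; apply: eq_mulcoef => k l e.
all: rewrite mcoeff_truncation // (leq_ltn_trans _ md) // e mpoly.mdegD.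
  exact: leq_addr.
exact: leq_addl.
Qed.

Lemma mulcoef0 n (a b : mnm n -> C) : mulcoef a b mpoly.mnm0 = a mpoly.mnm0 * b mpoly.mnm0.
Proof.
rewrite (mulcoef_truncation (d := 1)) ?mpoly.mdeg0 //.
by rewrite (rmorphM (mpoly.mcoeff mpoly.mnm0)) /= !mcoeff_truncation ?mpoly.mdeg0.
Qed.

(* The derivative along x_i at a monomial free of x_i: no integer factors appear. *)
Lemma mulcoefDU n (a b : mnm n -> C) (m : mnm n) i : m i = 0%N ->
  mulcoef a b (mnmD m (U_ i)) =
    mulcoef (fun k => a (mnmD k (U_ i))) b m + mulcoef a (fun k => b (mnmD k (U_ i))) m.
Proof.
(* The truncation has to keep the monomials of degree [mdeg m + 1]. *)
move=> mi; pose d := (mdeg m).+2.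
have le1 k l : m = mnmD k l -> (mdeg k <= mdeg m)%N by move=> ->; rewrite mpoly.mdegD leq_addr.
have le2 k l : m = mnmD k l -> (mdeg l <= mdeg m)%N by move=> ->; rewrite mpoly.mdegD leq_addl.
have i1 k l : m = mnmD k l -> k i = 0%N.
  by move=> e; apply/eqP; rewrite -leqn0 -mi e mpoly.mnmDE leq_addr.
have i2 k l : m = mnmD k l -> l i = 0%N.
  by move=> e; apply/eqP; rewrite -leqn0 -mi e mpoly.mnmDE leq_addl.
rewrite (mulcoef_truncation (d := d)) ?mpoly.mdegD ?mpoly.mdeg1 ?addn1 //.
set pq := _ * _; have -> : mpoly.mcoeff (mnmD m (U_ i)) pq = mpoly.mcoeff m (mpoly.mderiv i pq).
  by rewrite mpoly.mcoeff_mderiv mi.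
rewrite mpoly.mderivM mpoly.mcoeffD !mcoeff_mulcoef; congr (_ + _).
  apply: eq_mulcoef => k l e.
    rewrite mpoly.mcoeff_mderiv (i1 _ _ e) mcoeff_truncation //.
    by rewrite mpoly.mdegD mpoly.mdeg1 addn1 !ltnS (le1 _ _ e).
  by rewrite mcoeff_truncation // ltnS leqW // (le2 _ _ e).
apply: eq_mulcoef => k l e.
  by rewrite mcoeff_truncation // ltnS leqW // (le1 _ _ e).
rewrite mpoly.mcoeff_mderiv (i2 _ _ e) mcoeff_truncation //.
by rewrite mpoly.mdegD mpoly.mdeg1 addn1 !ltnS (le2 _ _ e).
Qed.

Lemma coord_coefDU n i (b : cps R n) m : (coord R i * b) (mnmD m (U_ i)) = b m.
Proof.
rewrite Defs.coefM; pose d := (mdeg m).+2.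
transitivity (mpoly.mcoeff (mnmD (U_ i) m) (truncation d b * mpoly.mpolyX C (U_ i))).
  rewrite mulrC mcoeff_mulcoef mpoly.addmC; apply: eq_mulcoef => k l e.
    by rewrite mpoly.mcoeffX eq_sym.
  rewrite mcoeff_truncation // ltnS -addn1 -(mpoly.mdeg1 i) -mpoly.mdegD mpoly.addmC e.
  by rewrite mpoly.mdegD leq_addl.
by rewrite mpoly.mcoeffMX mcoeff_truncation // ltnW.
Qed.

Lemma coord_coef0 n i (b : cps R n) (m : mnm n) : m i = 0%N -> (coord R i * b) m = 0.
Proof.
move=> mi; rewrite Defs.coefM /mulcoef big1 // => -[k l] /= /eqP e; rewrite /=.
case: eqP => [ki|_]; last by rewrite mul0r.
by move: (congr1 (fun m' : mnm n => m' i) e); rewrite mi ki mpoly.mnmDE mpoly.mnm1E eqxx.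
Qed.

(** Every nonzero term of the norm of b is a term of the norm of a divided by r^c, and by
    injectivity no term is used twice; hence the bound M / r^c. Division by a coordinate, slices and
    lifts are all reindexings of this kind. *)
Lemma convergent_reindex p q (P : pred (mnm p)) (h : mnm p -> mnm q) c
    (a : mnm q -> C^o) (b : mnm p -> C^o) :
  convergent a -> {in P &, injective h} -> (forall m, ~~ P m -> b m = 0) ->
  (forall m, P m -> b m = a (h m)) -> (forall m, P m -> mdeg (h m) = (mdeg m + c)%N) ->
  convergent b.
Proof.
move=> [r [M [r0 aM]]] hinj b0 ba hdeg.
exists r, (M / r ^+ c); split=> // d.
rewrite ler_pdivlMr ?exprn_gt0 //.
apply: le_trans (aM (d + c)%N); rewrite /pnorm mulr_suml.
pose F (m : mnm q) : C := `|a m| * r ^+ mdeg m.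
have F0 m : 0 <= F m by apply: mulr_ge0; [exact: normr_ge0|exact/exprn_ge0/ltW].
pose Q (k : mpoly.bmultinom p d) (l : mpoly.bmultinom q (d + c)) :=
  P (mpoly.bmnm k) && (mpoly.bmnm l == h (mpoly.bmnm k)).
have /le_trans -> // : \sum_(k : mpoly.bmultinom p d)
      `|b (mpoly.bmnm k)| * r ^+ mdeg (mpoly.bmnm k) * r ^+ c <=
    \sum_(k : mpoly.bmultinom p d) \sum_(l : mpoly.bmultinom q (d + c) | Q k l) F (mpoly.bmnm l).
  apply: ler_sum => k _; have [Pk|nPk] := boolP (P (mpoly.bmnm k)); last first.
    by rewrite b0 // normr0 !mul0r; apply: sumr_ge0 => l _; exact: F0.
  have hk : (mdeg (h (mpoly.bmnm k)) < d + c)%N by rewrite hdeg // ltn_add2r mpoly.bmdeg.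
  rewrite (bigD1 (mpoly.BMultinom hk)) /=; last by rewrite /Q Pk eqxx.
  rewrite -mulrA -exprD -hdeg // ba // ler_wpDr //.
  by apply: sumr_ge0 => l _; exact: F0.
(* After the exchange, injectivity leaves at most one k for each l. *)
rewrite (exchange_big_dep xpredT) //=; apply: ler_sum => l _.
case: (pickP (Q^~ l)) => [k Qk|Q0]; last by rewrite big_pred0 ?F0.
rewrite (big_pred1 k) // => k'; move: Qk => /andP[Pk /eqP lk].
apply/andP/eqP => [[Pk' /eqP lk']|->]; last by rewrite lk.
by apply/val_inj/hinj => //; rewrite -lk -lk'.
Qed.

Lemma cps_convergent n (a : cps R n) : convergent a.
Proof. by case: a => a /= /asboolP. Qed.

Lemma cps_divide_coords n (a : cps R n) : a mpoly.mnm0 = 0 ->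
  exists b : 'I_n -> cps R n, a = \sum_i coord R i * b i.
Proof.
move=> a0.
(* Each monomial is charged to the first variable dividing it. *)
pose P (i : 'I_n) (m : mnm n) := [forall j : 'I_n, (j < i)%N ==> (m j == 0%N)].
(* The part of a charged to x_i, divided by x_i. *)
pose bcoef i (m : mnm n) : C^o := if P i m then a (mnmD m (U_ i)) else 0.
have bconv i : convergent (bcoef i).
  apply: (convergent_reindex (P := P i) (h := fun m => mnmD m (U_ i)) (c := 1) (cps_convergent a)).
  - move=> m m' _ _ /(congr1 (fun k : mnm n => mpoly.mnm_sub k (U_ i))).
    by rewrite !mpoly.addmK.
  - by move=> m /negPf nP; rewrite /bcoef nP.
  - by move=> m Pm; rewrite /bcoef Pm.
  by move=> m _; rewrite mpoly.mdegD mpoly.mdeg1.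
exists (fun i => CPS (asboolT (bconv i))); apply/cpsP => m.
have sumE (F : 'I_n -> cps R n) : (\sum_i F i) m = \sum_i F i m.
  exact: (big_morph (fun f : cps R n => f m) (id1 := 0) (op1 := +%R)).
rewrite sumE; have [[i mi]|m0] := pselect (exists i, m i != 0%N); last first.
  have z i : m i = 0%N by apply/eqP/negPn/negP => mi; apply: m0; exists i.
  have -> : m = mpoly.mnm0 by apply/mpoly.mnmP => i; rewrite z mpoly.mnm0E.
  by rewrite a0 big1 // => i _; rewrite coord_coef0 // mpoly.mnm0E.
(* [i0] is the first variable dividing m; only its summand contributes at m. *)
have [i0 i0m i0min] := @arg_minnP _ i (fun j => m j != 0%N) (fun j => j : nat) mi.
have shift j : m j != 0%N -> m = mnmD (mpoly.mnm_sub m (U_ j)) (U_ j).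
  move=> mj; rewrite mpoly.submK //; apply/mpoly.mnm_lepP => l.
  by rewrite mpoly.mnm1E; case: eqP => // <-; rewrite lt0n.
rewrite (bigD1 i0) // big1 => [|j ji0].
  apply: etrans (esym (addr0 _)); rewrite [in RHS](shift i0) // coord_coefDU /= /bcoef.
  case: ifP => [_|/forallP[]]; first by rewrite -shift.
  move=> j; apply/implyP => ji0; rewrite mpoly.mnmBE; apply/eqP.
  rewrite [m j](_ : _ = 0%N) //; apply/eqP/negPn/negP => /i0min.
  by rewrite leqNgt ji0.
have [mj|mj] := eqVneq (m j) 0%N; first by rewrite coord_coef0.
rewrite (shift j) // coord_coefDU /= /bcoef; case: ifP => // /forallP/(_ i0).
rewrite mpoly.mnmBE mpoly.mnm1E (negPf ji0) subn0 (negPf i0m) implybF -leqNgt => ji0'.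
by case/eqP: ji0; apply/val_inj/eqP; rewrite eqn_leq /= ji0' i0min.
Qed.

End MulCoef.

Section FatPoint.
Variable R : realType.
Local Notation C := (R[i]).

Section TangentVectors.
Variables (X : germ R) (v : tangent X).

Fact tangentP : derivation_at0 v.
Proof. by apply/asboolP; case: v. Qed.

Lemma tangentD f g : v (f + g) = v f + v g. Proof. by case: tangentP. Qed.
Lemma tangentZ c f : v (c *: f) = c * v f. Proof. by case: tangentP. Qed.
Lemma tangentM f g : v (f * g) = gval f * v g + gval g * v f. Proof. by case: tangentP. Qed.

Lemma tangent0 : v 0 = 0.
Proof. by rewrite -(scale0r 0) tangentZ mul0r. Qed.

Lemma tangent1 : v 1 = 0.
Proof.
have /eqP := tangentM 1 1; rewrite mulr1 gval1 !mul1r -subr_eq subrr eq_sym.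
by move=> /eqP.
Qed.

Lemma tangent_sum I (r : seq I) (F : I -> gfun X) :
  v (\sum_(i <- r) F i) = \sum_(i <- r) v (F i).
Proof. exact: (big_morph v tangentD tangent0). Qed.

End TangentVectors.

Lemma coefMU n (a b : cps R n) i :
  (a * b) (U_ i) = a (U_ i) * b mpoly.mnm0 + a mpoly.mnm0 * b (U_ i).
Proof.
rewrite Defs.coefM -[U_ i in LHS]mpoly.add0m mulcoefDU ?mpoly.mnm0E //.
by rewrite !mulcoef0 !mpoly.add0m.
Qed.

Lemma coord_at0 n (i : 'I_n) : coord R i mpoly.mnm0 = 0.
Proof. by rewrite -[coord R i]mulr1 coord_coef0 ?mpoly.mnm0E. Qed.

Lemma coord_atU n (i j : 'I_n) : coord R i (U_ j) = (i == j)%:R.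
Proof.
congr (_%:R); congr nat_of_bool; apply/eqP/eqP => [|->//].
by move=> /(congr1 (fun k : mnm n => k i)); rewrite !mpoly.mnm1E eqxx; case: eqP.
Qed.

Variable k : nat.
Local Notation F := (fat_point R k).

Lemma epsM i j : eps R i * eps R j = 0 :> gfun F.
Proof.
rewrite -gclassM; apply/(gclass_eq0 (X := F))/asboolP/ideal_span_gen.
by exists i, j.
Qed.

Lemma gval_eps i : gval (eps R i : gfun F) = 0.
Proof. by rewrite gval_class coord_at0. Qed.

Let lin (i : 'I_k) (f : gfun F) : C^o := grepr f (U_ i).

(** Elements of the ideal are combinations of products of two coordinates, whose linear coefficients
    vanish by the product rule. *)
Let lin_class (i : 'I_k) (a : cps R k) : lin i (gclass (X := F) a) = a (U_ i).
Proof.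
have : grepr (gclass (X := F) a) - a \in gideal F by apply/gclass_eq; rewrite greprK.
move=> /asboolP[n [c [e [esq da]]]]; apply/eqP; rewrite -subr_eq0.
rewrite -[X in X == _]/((grepr (gclass (X := F) a) - a) (U_ i)) da.
have sumE (E : 'I_n -> cps R k) : (\sum_l E l) (U_ i) = \sum_l E l (U_ i).
  exact: (big_morph (fun f : cps R k => f (U_ i)) (id1 := 0) (op1 := +%R)).
rewrite sumE big1 // => l _; have [j [j' ->]] := esq l.
by rewrite coefMU coefMU coefM0 !coord_at0 !(mulr0, mul0r, addr0).
Qed.

Fact fat_tangent_derivation (i : 'I_k) : lin i \in @der_pred R F.
Proof.
apply/asboolP; split=> [f g|c f|f g].
- by rewrite -[f]greprK -[g]greprK -gclassD !lin_class.
- by rewrite -[f]greprK [c *: _]gclassZ !lin_class.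
rewrite -[f]greprK -[g]greprK -gclassM !lin_class !gval_class coefMU.
by rewrite addrC [X in _ + X]mulrC.
Qed.

(** The tangent vector dual to [eps R i]. *)
Definition fat_tangent (i : 'I_k) : tangent F := Tangent (fat_tangent_derivation i).

Lemma fat_tangent_eps i j : fat_tangent i (eps R j) = (j == i)%:R.
Proof. by rewrite /= lin_class coord_atU. Qed.

Arguments fat_tangent : simpl never.

(** Dividing twice by the coordinates leaves a constant, a linear part and products of two
    coordinates, which are zero here. The coefficients are then identified by applying [gval] and
    the dual tangent vectors. *)
Lemma fat_point_decomp (f : gfun F) :
  f = (gval f)%:A + \sum_i fat_tangent i f *: eps R i.
Proof.
suff [c [d fE]] : exists c (d : 'I_k -> C), f = c%:A + \sum_i d i *: eps R i.
  rewrite [LHS]fE; congr (_ + _).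
    rewrite fE gvalD gvalZ gval1 mulr1 gval_sum big1 ?addr0 // => i _.
    by rewrite gvalZ gval_eps mulr0.
  apply: eq_bigr => i _; congr (_ *: _).
  rewrite fE tangentD tangentZ tangent1 mulr0 add0r tangent_sum (bigD1 i) // big1 => [|j /negPf ji].
    by apply: etrans (esym (addr0 _)); rewrite tangentZ fat_tangent_eps eqxx mulr1.
  by rewrite tangentZ fat_tangent_eps ji mulr0.
have divide (a : cps R k) : exists b : 'I_k -> cps R k,
    a = (a mpoly.mnm0)%:A + \sum_i coord R i * b i.
  have a0 : (a - (a mpoly.mnm0)%:A) mpoly.mnm0 = 0.
    rewrite -scaleNr Defs.coefD Defs.coefZ /= /onecoef eqxx mulr1.
    exact: subrr.
  have [b bE] := cps_divide_coords a0.
  by exists b; rewrite -bE addrC subrK.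
have [b fE] := divide (grepr f).
exists (grepr f mpoly.mnm0), (fun i => b i mpoly.mnm0).
rewrite -[LHS]greprK [in LHS]fE gclassD; congr (_ + _).
  by apply: etrans (esym (gclassZ (X := F) _ _)) _; rewrite (gclass1 F).
rewrite rmorph_sum; apply: eq_bigr => i _ /=.
have [b' bE] := divide (b i); rewrite gclassM [in LHS]bE gclassD mulrDr.
rewrite [X in _ + X](_ : _ = 0) ?addr0; last first.
  rewrite rmorph_sum mulr_sumr big1 // => j _ /=.
  by rewrite gclassM mulrA [X in X * _]epsM mul0r.
by rewrite -gclassM -scalerAr mulr1; exact/esym/(gclassZ (X := F)).
Qed.

Section TangentMor.
Variables (X : germ R) (v : 'I_k -> tangent X).

Let tmap (f : gfun X) : gfun F := (gval f)%:A + \sum_i v i f *: eps R i.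

(** The map is multiplicative because the v_i are derivations and all products of two [eps] vanish.
    Thus k tangent vectors give a morphism from the fat point. *)
Definition tangent_mor : mor F X.
Proof.
apply: (@make_mor R F X tmap) => [f g|c f|f g||f].
- rewrite /tmap gvalD scalerDl addrACA -big_split /=; congr (_ + _).
  by apply: eq_bigr => i _; rewrite tangentD scalerDl.
- rewrite /tmap gvalZ scalerDr scalerA scaler_sumr; congr (_ + _).
  by apply: eq_bigr => i _; rewrite tangentZ scalerA.
- rewrite /tmap mulrDl !mulrDr [X in _ = _ + (_ + X)](_ : _ = 0); last first.
    rewrite mulr_suml big1 // => i _; rewrite mulr_sumr big1 // => j _.
    by rewrite -scalerAl -scalerAr epsM !scaler0.
  rewrite addr0 !mulr_algl mulr_algr scalerA -gvalM -addrA; congr (_ + _).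
  rewrite !scaler_sumr -big_split /=; apply: eq_bigr => i _.
  by rewrite tangentM scalerDl !scalerA.
- rewrite /tmap gval1 scale1r big1 ?addr0 // => i _.
  by rewrite tangent1 scale0r.
rewrite /tmap gvalD gvalZ gval1 mulr1 gval_sum big1 ?addr0 // => i _.
by rewrite gvalZ gval_eps mulr0.
Defined.

Lemma tangent_morE f : tangent_mor f = (gval f)%:A + \sum_i v i f *: eps R i.
Proof. by []. Qed.

End TangentMor.
End FatPoint.

(** * Product of a germ with a fat point *)

(* A series in (x, e) modulo (e)^2 is determined by its slices a(x, 0) and (da/de_j)(x, 0). *)
Section Slices.
Variables (R : realType) (n k : nat).
Local Notation C := (R[i]).

Definition mnm_widen (m : mnm n) : mnm (n + k) :=
  mpoly.Multinom [tuple (match fintype.split i with inl j => m j | inr _ => 0%N end) | i < n + k].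
Definition mnm_restrict (m : mnm (n + k)) : mnm n :=
  mpoly.Multinom [tuple m (lshift k i) | i < n].

Lemma mnm_widenl (m : mnm n) i : mnm_widen m (lshift k i) = m i.
Proof. by rewrite mpoly.mnmE (unsplitK (inl i)). Qed.

Lemma mnm_widenr m j : mnm_widen m (rshift n j) = 0%N.
Proof. by rewrite mpoly.mnmE (unsplitK (inr j)). Qed.

Lemma mnm_restrictE (m : mnm (n + k)) i : mnm_restrict m i = m (lshift k i).
Proof. exact: mpoly.mnmE. Qed.

Lemma mnm_widenK m : mnm_restrict (mnm_widen m) = m.
Proof. by apply/mpoly.mnmP => i; rewrite mnm_restrictE mnm_widenl. Qed.

Lemma mnm_restrictK (m : mnm (n + k)) :
  (forall j, m (rshift n j) = 0%N) -> mnm_widen (mnm_restrict m) = m.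
Proof.
move=> mr; apply/mpoly.mnmP => i; rewrite -(splitK i).
case: (fintype.split i) => j /=; first by rewrite mnm_widenl mnm_restrictE.
by rewrite mnm_widenr mr.
Qed.

Lemma mdeg_widen m : mdeg (mnm_widen m) = mdeg m.
Proof.
rewrite !mpoly.mdegE big_split_ord /= [X in (_ + X)%N]big1 ?addn0.
  by apply: eq_bigr => i _; rewrite mnm_widenl.
by move=> i _; rewrite mnm_widenr.
Qed.

Lemma mnm_widenD m m' : mnm_widen (mnmD m m') = mnmD (mnm_widen m) (mnm_widen m').
Proof.
apply/mpoly.mnmP => i; rewrite -(splitK i) mpoly.mnmDE.
by case: (fintype.split i) => j /=; rewrite ?(mnm_widenl, mnm_widenr) ?mpoly.mnmDE.
Qed.

(** Factors of a monomial free of the e_j are free of them too. The condition has the form needed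
    for reindexing along [mnm_widen]. *)
Lemma mnm_widen_eq m K L : (mnm_widen m == mnmD K L) =
  [&& mnm_widen (mnm_restrict K) == K, mnm_widen (mnm_restrict L) == L &
      m == mnmD (mnm_restrict K) (mnm_restrict L)].
Proof.
apply/eqP/and3P => [e|[/eqP eK /eqP eL /eqP em]]; last by rewrite em mnm_widenD eK eL.
have K0 j : K (rshift n j) = 0%N.
  by apply/eqP; rewrite -leqn0 -(mnm_widenr m j) e mpoly.mnmDE leq_addr.
have L0 j : L (rshift n j) = 0%N.
  by apply/eqP; rewrite -leqn0 -(mnm_widenr m j) e mpoly.mnmDE leq_addl.
rewrite !mnm_restrictK //; split=> //.
rewrite -(mnm_widenK m) e; apply/eqP/mpoly.mnmP => i.
by rewrite mpoly.mnmDE !mnm_restrictE mpoly.mnmDE.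
Qed.

Lemma mulcoef_widen (a b : mnm (n + k) -> C) m :
  mulcoef a b (mnm_widen m) = mulcoef (a \o mnm_widen) (b \o mnm_widen) m.
Proof.
rewrite /mulcoef mdeg_widen; set d := (mdeg m).+1.
have wid_lt (K : mpoly.bmultinom n d) : (mdeg (mnm_widen (mpoly.bmnm K)) < d)%N.
  by rewrite mdeg_widen mpoly.bmdeg.
have res_lt (K : mpoly.bmultinom (n + k) d) : (mdeg (mnm_restrict (mpoly.bmnm K)) < d)%N.
  apply: leq_ltn_trans (mpoly.bmdeg K); rewrite !mpoly.mdegE big_split_ord /=.
  by rewrite -[X in (X <= _)%N]addn0 leq_add // leq_sum // => i _; rewrite mnm_restrictE.
pose w (K : mpoly.bmultinom n d) := mpoly.BMultinom (wid_lt K).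
pose r (K : mpoly.bmultinom (n + k) d) := mpoly.BMultinom (res_lt K).
pose w2 (p : mpoly.bmultinom n d * mpoly.bmultinom n d) := (w p.1, w p.2).
pose r2 (p : mpoly.bmultinom (n + k) d * mpoly.bmultinom (n + k) d) := (r p.1, r p.2).
rewrite (reindex_onto w2 r2) /=; last first.
  move=> [K L]; rewrite /= mnm_widen_eq => /and3P[/eqP eK /eqP eL _].
  by congr pair; apply/val_inj.
apply: eq_big => // -[K L]; rewrite /= mnm_widen_eq !mnm_widenK !eqxx /=.
rewrite [X in _ && X](_ : _ = true) ?andbT //; apply/eqP.
by congr pair; apply/val_inj; rewrite /= mnm_widenK.
Qed.

Fact slice0_convergent (a : cps R (n + k)) : convergent (a \o mnm_widen).
Proof.
apply: (convergent_reindex (P := predT) (h := mnm_widen) (c := 0) (cps_convergent a)) => //.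
  by move=> m m' _ _ /(congr1 mnm_restrict); rewrite !mnm_widenK.
by move=> m _; rewrite mdeg_widen addn0.
Qed.

Definition slice0 (a : cps R (n + k)) : cps R n := CPS (asboolT (slice0_convergent a)).

Definition mnm_widenU j m := mnmD (mnm_widen m) (U_ (rshift n j)).

Fact slice1_convergent j (a : cps R (n + k)) : convergent (a \o mnm_widenU j).
Proof.
apply: (convergent_reindex (P := predT) (h := mnm_widenU j) (c := 1) (cps_convergent a)) => //.
  move=> m m' _ _ /(congr1 (fun l : mnm (n + k) => mpoly.mnm_sub l (U_ (rshift n j)))).
  by rewrite !mpoly.addmK => /(congr1 mnm_restrict); rewrite !mnm_widenK.
by move=> m _; rewrite mpoly.mdegD mpoly.mdeg1 mdeg_widen.
Qed.

Definition slice1 j (a : cps R (n + k)) : cps R n := CPS (asboolT (slice1_convergent j a)).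

Lemma mnm_widen0 : mnm_widen mpoly.mnm0 = mpoly.mnm0.
Proof.
rewrite -[RHS]mnm_restrictK => [|j]; last by rewrite mpoly.mnm0E.
by congr mnm_widen; apply/mpoly.mnmP => i; rewrite mnm_restrictE !mpoly.mnm0E.
Qed.

Lemma slice0_at0 a : slice0 a mpoly.mnm0 = a mpoly.mnm0.
Proof. by rewrite /= mnm_widen0. Qed.

Lemma slice0M a b : slice0 (a * b) = slice0 a * slice0 b.
Proof. by apply/cpsP => m; exact: mulcoef_widen. Qed.

Lemma slice1M j a b : slice1 j (a * b) = slice1 j a * slice0 b + slice0 a * slice1 j b.
Proof.
apply/cpsP => m; rewrite Defs.coefD [LHS]mulcoefDU ?mnm_widenr //.
by congr (_ + _); exact: mulcoef_widen.
Qed.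

Lemma slice0_1 : slice0 1 = 1.
Proof.
apply/cpsP => m; rewrite /= /onecoef -mnm_widen0; congr (_%:R); congr nat_of_bool.
by apply/eqP/eqP => [/(congr1 mnm_restrict)|->//]; rewrite !mnm_widenK.
Qed.

Lemma slice1_1 j : slice1 j 1 = 0.
Proof.
have /eqP := slice1M j 1 1; rewrite !mulr1 slice0_1 mulr1 mul1r -subr_eq subrr eq_sym.
by move=> /eqP.
Qed.

(** The test singles out the monomials without any e_j: this is a(x) regarded as a series in (x,
    e). *)
Definition cps_lift_coef (a : mnm n -> C) (m : mnm (n + k)) : C :=
  if mnm_widen (mnm_restrict m) == m then a (mnm_restrict m) else 0.

Fact cps_lift_convergent (a : cps R n) : convergent (cps_lift_coef a).
Proof.
apply: (convergent_reindex (P := fun m => mnm_widen (mnm_restrict m) == m)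
   (h := mnm_restrict) (c := 0) (cps_convergent a)).
- by move=> m m' /eqP em /eqP em' e; rewrite -em -em' e.
- by move=> m /negPf e; rewrite /cps_lift_coef e.
- by move=> m e; rewrite /cps_lift_coef e.
by move=> m /eqP e; rewrite -{2}e mdeg_widen addn0.
Qed.

Definition cps_lift (a : cps R n) : cps R (n + k) := CPS (asboolT (cps_lift_convergent a)).

Lemma slice0_lift a : slice0 (cps_lift a) = a.
Proof. by apply/cpsP => m; rewrite /= /cps_lift_coef !mnm_widenK eqxx. Qed.

Lemma slice1_lift j a : slice1 j (cps_lift a) = 0.
Proof.
apply/cpsP => m; rewrite /= /cps_lift_coef; case: eqP => //.
move=> /(congr1 (fun l : mnm (n + k) => l (rshift n j))).
by rewrite mnm_widenr mpoly.mnmDE mpoly.mnm1E eqxx addn1.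
Qed.

Lemma slice0_coord j : slice0 (coord R (rshift n j)) = 0.
Proof.
apply/cpsP => m; rewrite /=; case: eqP => // /(congr1 (fun l : mnm (n + k) => l (rshift n j))).
by rewrite mnm_widenr mpoly.mnm1E eqxx.
Qed.

Lemma slice1_coord j l : slice1 j (coord R (rshift n l)) = (j == l)%:R.
Proof.
apply/cpsP => m; rewrite /=; have [<-|jl] := eqVneq j l.
  rewrite -[X in _ == X]mpoly.add0m mpoly.eqm_add2r -mnm_widen0.
  congr (_%:R); congr nat_of_bool.
  by apply/eqP/eqP => [/(congr1 mnm_restrict)|->//]; rewrite !mnm_widenK.
case: eqP => // /(congr1 (fun l : mnm (n + k) => l (rshift n j))).
by rewrite mpoly.mnmDE mnm_widenr !mpoly.mnm1E eqxx eq_sym (inj_eq (@rshift_inj _ _)) (negPf jl).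
Qed.

End Slices.

Section FatProduct.
Variables (R : realType) (X : germ R) (k : nat).
Local Notation C := (R[i]).
Local Notation n := (gdim X).

(* The kernel of a |-> (a(x, 0), (da/de_j)(x, 0)) in O_X + sum_j O_X e_j, which makes division
   by the monomials e_i e_j unnecessary. *)
Definition fat_product_gens : set (cps R (n + k)) :=
  [set a | slice0 a \in gideal X /\ forall j, slice1 j a \in gideal X].

Fact fat_product_gens_at0 (a : cps R (n + k)) : fat_product_gens a -> a mpoly.mnm0 = 0.
Proof. by move=> [/gideal_at0]; rewrite slice0_at0. Qed.

Definition fat_product : germ R := germ_of_gens fat_product_gens_at0.
Local Notation Y := fat_product.

Let slice0D (a b : cps R (n + k)) : slice0 (a + b) = slice0 a + slice0 b.
Proof. exact/cpsP. Qed.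
Let slice1D j (a b : cps R (n + k)) : slice1 j (a + b) = slice1 j a + slice1 j b.
Proof. exact/cpsP. Qed.
Let slice0Z c (a : cps R (n + k)) : slice0 (c *: a) = c *: slice0 a.
Proof. exact/cpsP. Qed.
Let slice1Z j c (a : cps R (n + k)) : slice1 j (c *: a) = c *: slice1 j a.
Proof. exact/cpsP. Qed.

(** The generators already form an ideal, by the product rules for the slices. *)
Lemma fat_product_idealP (a : cps R (n + k)) : a \in gideal Y <-> fat_product_gens a.
Proof.
split=> [/asboolP[p [c [e [Ee ->]]]]|Ea]; last exact/asboolP/ideal_span_gen.
elim/big_ind : _ => [|x y [x0 xU] [y0 yU]|i _].
- split=> [|j]; first by rewrite [slice0 0](_ : _ = 0) ?rpred0 //; exact/cpsP.
  by rewrite [slice1 j 0](_ : _ = 0) ?rpred0 //; exact/cpsP.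
- by split=> [|j]; rewrite ?slice0D ?slice1D rpredD.
have [e0 eU] := Ee i; split=> [|j]; rewrite ?slice0M ?slice1M ?idealMr //.
by rewrite rpredD ?idealMr.
Qed.

(** With [fat_coef1], the coordinates of O_Y = O_X + sum_j O_X e_j as a free O_X-module. *)
Definition fat_coef0 (f : gfun Y) : gfun X := gclass (slice0 (grepr f)).
Definition fat_coef1 j (f : gfun Y) : gfun X := gclass (slice1 j (grepr f)).

Let repr_ideal (a : cps R (n + k)) : fat_product_gens (grepr (gclass (X := Y) a) - a).
Proof. by apply/fat_product_idealP/(gclass_eq (X := Y)); rewrite greprK. Qed.

Let subN (a b : cps R (n + k)) : a - b = a + (-1) *: b. Proof. by rewrite scaleN1r. Qed.

Lemma fat_coef0_class (a : cps R (n + k)) : fat_coef0 (gclass (X := Y) a) = gclass (slice0 a).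
Proof.
rewrite /fat_coef0; apply/gclass_eq; have [+ _] := repr_ideal a.
by rewrite subN slice0D slice0Z scaleN1r.
Qed.

Lemma fat_coef1_class j (a : cps R (n + k)) : fat_coef1 j (gclass (X := Y) a) = gclass (slice1 j a).
Proof.
rewrite /fat_coef1; apply/gclass_eq; have [_ /(_ j)] := repr_ideal a.
by rewrite subN slice1D slice1Z scaleN1r.
Qed.

Lemma fat_coef_inj (f g : gfun Y) : fat_coef0 f = fat_coef0 g ->
  (forall j, fat_coef1 j f = fat_coef1 j g) -> f = g.
Proof.
move=> e0 e1; rewrite -[f]greprK -[g]greprK; apply/(gclass_eq (X := Y))/fat_product_idealP.
split=> [|j]; rewrite subN ?slice0D ?slice0Z ?slice1D ?slice1Z scaleN1r; apply/gclass_eq.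
  exact: e0.
exact: e1.
Qed.

Lemma fat_coef0D f g : fat_coef0 (f + g) = fat_coef0 f + fat_coef0 g.
Proof. by rewrite -[f]greprK -[g]greprK -gclassD !fat_coef0_class slice0D gclassD. Qed.

Lemma fat_coef1D j f g : fat_coef1 j (f + g) = fat_coef1 j f + fat_coef1 j g.
Proof. by rewrite -[f]greprK -[g]greprK -gclassD !fat_coef1_class slice1D gclassD. Qed.

Lemma fat_coef0Z c f : fat_coef0 (c *: f) = c *: fat_coef0 f.
Proof.
rewrite -[f]greprK [c *: _]gclassZ !fat_coef0_class slice0Z.
exact/esym/(gclassZ (X := X)).
Qed.

Lemma fat_coef1Z j c f : fat_coef1 j (c *: f) = c *: fat_coef1 j f.
Proof.
rewrite -[f]greprK [c *: _]gclassZ !fat_coef1_class slice1Z.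
exact/esym/(gclassZ (X := X)).
Qed.

Lemma fat_coef0_0 : fat_coef0 0 = 0.
Proof. by have := fat_coef0Z 0 0; rewrite !scale0r. Qed.

Lemma fat_coef1_0 j : fat_coef1 j 0 = 0.
Proof. by have := fat_coef1Z j 0 0; rewrite !scale0r. Qed.

Lemma fat_coef0M f g : fat_coef0 (f * g) = fat_coef0 f * fat_coef0 g.
Proof. by rewrite -[f]greprK -[g]greprK -gclassM !fat_coef0_class slice0M gclassM. Qed.

Lemma fat_coef1M j f g :
  fat_coef1 j (f * g) = fat_coef1 j f * fat_coef0 g + fat_coef0 f * fat_coef1 j g.
Proof.
rewrite -[f]greprK -[g]greprK -gclassM !fat_coef0_class !fat_coef1_class.
by rewrite slice1M gclassD !gclassM.
Qed.

Lemma fat_coef0_1 : fat_coef0 1 = 1.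
Proof. by rewrite -(gclass1 Y) fat_coef0_class slice0_1 gclass1. Qed.

Lemma fat_coef1_1 j : fat_coef1 j 1 = 0.
Proof. by rewrite -(gclass1 Y) fat_coef1_class slice1_1; exact: (rmorph0 (@gclass R X)). Qed.

Let lift_fun (f : gfun X) : gfun Y := gclass (X := Y) (cps_lift k (grepr f)).

Let lift_coef0 f : fat_coef0 (lift_fun f) = f.
Proof. by rewrite fat_coef0_class slice0_lift greprK. Qed.

Let lift_coef1 j f : fat_coef1 j (lift_fun f) = 0.
Proof. by rewrite fat_coef1_class slice1_lift; exact: (rmorph0 (@gclass R X)). Qed.

Definition fat_proj : mor Y X.
Proof.
apply: (@make_mor R Y X lift_fun) => [f g|c f|f g||f].
- by apply: fat_coef_inj => [|j]; rewrite ?fat_coef0D ?fat_coef1D ?lift_coef0 ?lift_coef1 ?addr0.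
- by apply: fat_coef_inj => [|j]; rewrite ?fat_coef0Z ?fat_coef1Z ?lift_coef0 ?lift_coef1 ?scaler0.
- apply: fat_coef_inj => [|j]; rewrite ?fat_coef0M ?fat_coef1M ?lift_coef0 ?lift_coef1 //.
  by rewrite mul0r mulr0 addr0.
- by apply: fat_coef_inj => [|j]; rewrite ?lift_coef0 ?lift_coef1 ?fat_coef0_1 ?fat_coef1_1.
by rewrite gval_class -slice0_at0 slice0_lift.
Defined.

Definition fat_eps (j : 'I_k) : gfun Y := gclass (X := Y) (coord R (rshift n j)).

Lemma fat_coef0_proj f : fat_coef0 (fat_proj f) = f. Proof. exact: lift_coef0. Qed.

Lemma fat_coef1_proj j f : fat_coef1 j (fat_proj f) = 0. Proof. exact: lift_coef1. Qed.

Lemma fat_coef0_eps j : fat_coef0 (fat_eps j) = 0.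
Proof. by rewrite fat_coef0_class slice0_coord; exact: (rmorph0 (@gclass R X)). Qed.

Lemma fat_coef1_eps j l : fat_coef1 j (fat_eps l) = (j == l)%:R.
Proof. by rewrite fat_coef1_class slice1_coord; exact: (rmorph_nat (@gclass R X)). Qed.

Lemma fat_epsM j l : fat_eps j * fat_eps l = 0.
Proof.
apply: fat_coef_inj => [|i]; rewrite ?fat_coef0M ?fat_coef1M !fat_coef0_eps.
  by rewrite mul0r fat_coef0_0.
by rewrite mul0r mulr0 addr0 fat_coef1_0.
Qed.

Let sum_coef0 I (r : seq I) (F : I -> gfun Y) :
  fat_coef0 (\sum_(i <- r) F i) = \sum_(i <- r) fat_coef0 (F i).
Proof. exact: (big_morph fat_coef0 fat_coef0D fat_coef0_0). Qed.

Let sum_coef1 j I (r : seq I) (F : I -> gfun Y) :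
  fat_coef1 j (\sum_(i <- r) F i) = \sum_(i <- r) fat_coef1 j (F i).
Proof. exact: (big_morph (fat_coef1 j) (fat_coef1D j) (fat_coef1_0 j)). Qed.

Definition fat_elem (x : gfun X) (y : 'I_k -> gfun X) : gfun Y :=
  fat_proj x + \sum_j fat_proj (y j) * fat_eps j.

Lemma fat_coef0_elem x y : fat_coef0 (fat_elem x y) = x.
Proof.
rewrite fat_coef0D sum_coef0 fat_coef0_proj big1 ?addr0 // => j _.
by rewrite fat_coef0M fat_coef0_eps mulr0.
Qed.

Lemma fat_coef1_elem x y j : fat_coef1 j (fat_elem x y) = y j.
Proof.
rewrite fat_coef1D sum_coef1 fat_coef1_proj add0r (bigD1 j) //= big1 => [|l lj].
  by rewrite addr0 fat_coef1M fat_coef1_proj mul0r add0r fat_coef0_proj fat_coef1_eps eqxx mulr1.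
rewrite fat_coef1M fat_coef1_proj mul0r add0r fat_coef0_proj fat_coef1_eps.
by rewrite eq_sym (negPf lj) mulr0.
Qed.

Lemma fat_decomp f : f = fat_elem (fat_coef0 f) (fat_coef1^~ f).
Proof. by apply: fat_coef_inj => [|j]; rewrite ?fat_coef0_elem ?fat_coef1_elem. Qed.

Lemma gval_fat_coef0 f : gval (fat_coef0 f) = gval f.
Proof.
rewrite [in RHS](fat_decomp f) gvalD gval_pull gval_sum big1 ?addr0 // => j _.
by rewrite gvalM (gval_sq0 (fat_epsM j j)) mulr0.
Qed.

Section UniversalProperty.
Variables (Z : germ R) (a : mor Z X) (z : 'I_k -> gfun Z).
Hypothesis zM : forall i j, z i * z j = 0.

Let pair_fun (f : gfun Y) : gfun Z := a (fat_coef0 f) + \sum_j a (fat_coef1 j f) * z j.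

(** The universal property of the product with the fat point. The vanishing of the products z_i z_j
    makes the formula multiplicative and puts the z_j in the maximal ideal. *)
Definition fat_pair : mor Z Y.
Proof.
apply: (@make_mor R Z Y pair_fun) => [f g|c f|f g||f]; rewrite /pair_fun.
- rewrite fat_coef0D rmorphD addrACA -big_split /=; congr (_ + _).
  by apply: eq_bigr => j _; rewrite fat_coef1D rmorphD mulrDl.
- rewrite fat_coef0Z linearZ scalerDr scaler_sumr /=; congr (_ + _).
  by apply: eq_bigr => j _; rewrite fat_coef1Z linearZ /= scalerAl.
- rewrite mulrDl !mulrDr [X in _ = _ + (_ + X)](_ : _ = 0); last first.
    rewrite mulr_suml big1 // => i _; rewrite mulr_sumr big1 // => j _.
    by rewrite mulrACA zM mulr0.
  rewrite addr0 fat_coef0M rmorphM -addrA; congr (_ + _).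
  rewrite mulr_sumr mulr_suml -big_split /=; apply: eq_bigr => j _.
  rewrite fat_coef1M rmorphD !rmorphM mulrDl addrC mulrA; congr (_ + _).
  by rewrite mulrAC.
- rewrite fat_coef0_1 rmorph1 big1 ?addr0 // => j _.
  by rewrite fat_coef1_1 rmorph0 mul0r.
rewrite gvalD gval_pull gval_sum big1 ?addr0 ?gval_fat_coef0 // => j _.
by rewrite gvalM (gval_sq0 (zM j j)) mulr0.
Defined.

Lemma fat_pair_elem x y : fat_pair (fat_elem x y) = a x + \sum_j a (y j) * z j.
Proof.
rewrite -[LHS]/(pair_fun _) /pair_fun fat_coef0_elem; congr (_ + _).
by apply: eq_bigr => j _; rewrite fat_coef1_elem.
Qed.

Lemma fat_pair_proj x : fat_pair (fat_proj x) = a x.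
Proof.
rewrite -[LHS]/(pair_fun _) /pair_fun fat_coef0_proj big1 ?addr0 // => j _.
by rewrite fat_coef1_proj rmorph0 mul0r.
Qed.

Lemma fat_pair_eps j : fat_pair (fat_eps j) = z j.
Proof.
rewrite -[LHS]/(pair_fun _) /pair_fun fat_coef0_eps rmorph0 add0r (bigD1 j) //= big1.
  by rewrite addr0 fat_coef1_eps eqxx rmorph1 mul1r.
by move=> l lj; rewrite fat_coef1_eps (negPf lj) rmorph0 mul0r.
Qed.

End UniversalProperty.

Lemma fat_mor_ext (Z : germ R) (c c' : mor Z Y) :
  (forall x, c (fat_proj x) = c' (fat_proj x)) -> (forall j, c (fat_eps j) = c' (fat_eps j)) ->
  forall f, c f = c' f.
Proof.
move=> cproj ceps f; rewrite (fat_decomp f) /fat_elem !rmorphD !rmorph_sum /= cproj.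
by congr (_ + _); apply: eq_bigr => j _; rewrite !rmorphM /= cproj ceps.
Qed.

End FatProduct.

Opaque fat_proj fat_pair.

Section FatProductDeformation.
Variables (R : realType) (X S : germ R) (pi : deformation X S) (k : nat).
Local Notation E := (total_space pi).
Local Notation Y := (fat_product E k).
Local Notation B := (fat_product S k).

(** The product of [pi] with the identity of the fat point. *)
Definition fat_projection : mor Y B :=
  fat_pair (mor_comp (projection pi) (fat_proj E k)) (@fat_epsM R E k).

Lemma fat_projection_proj f : fat_projection (fat_proj S k f) = fat_proj E k (projection pi f).
Proof. exact: fat_pair_proj. Qed.

Lemma fat_projection_eps j : fat_projection (fat_eps S j) = fat_eps E j.
Proof. exact: fat_pair_eps. Qed.

Lemma fat_coef0_projection f : fat_coef0 (fat_projection f) = projection pi (fat_coef0 f).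
Proof. by rewrite [in LHS](fat_decomp f) fat_pair_elem [LHS]fat_coef0_elem. Qed.

Opaque fat_projection.

(** Upstairs and downstairs, the product with the fat point is free on 1 and the e_j, so the square
    is a base change. A balanced map extends by beta'(x, b_0 + sum_j b_j e_j) = beta(x, b_0) + sum_j
    beta(e_j x, b_j). *)
Lemma fat_projection_flat : flat fat_projection.
Proof.
apply: (flat_base_change (i := fat_proj S k) (j := fat_proj E k) _ _ _ (@projection_flat _ _ _ pi)).
- by move=> f; exact/esym/fat_projection_proj.
- move=> b; exists ((1, fat_coef0 b) :: [seq (fat_eps S j, fat_coef1 j b) | j <- index_enum 'I_k]).
  rewrite big_cons big_map [LHS]fat_decomp /= rmorph1 mul1r; congr (_ + _).
  by apply: eq_bigr => j _; rewrite [X in _ = X * _]fat_projection_eps mulrC.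
move=> M P beta bD1 bD2 bZ.
have b0 x : beta x 0 = 0 by apply: (addIr (beta x 0)); rewrite -bD2 !add0r.
have b0l b : beta 0 b = 0 by apply: (addIr (beta 0 b)); rewrite -bD1 !add0r.
pose beta' (x : M) (b : gfun Y) : P :=
  beta x (fat_coef0 b) + \sum_j beta (fat_eps S j *: x) (fat_coef1 j b).
have b'D1 x y b : beta' (x + y) b = beta' x b + beta' y b.
  rewrite /beta' bD1 addrACA -big_split /=; congr (_ + _).
  by apply: eq_bigr => j _; rewrite scalerDr bD1.
have b'D2 x b c : beta' x (b + c) = beta' x b + beta' x c.
  rewrite /beta' fat_coef0D bD2 addrACA -big_split /=; congr (_ + _).
  by apply: eq_bigr => j _; rewrite fat_coef1D bD2.
have b'0 x : beta' x 0 = 0 by apply: (addIr (beta' x 0)); rewrite -b'D2 !add0r.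
have b'0l b : beta' 0 b = 0 by apply: (addIr (beta' 0 b)); rewrite -b'D1 !add0r.
(* Balancedness is stable under sums and products, so it suffices to test it on functions from S and
   on the e_j. *)
pose balanced a := forall x b, beta' (a *: x) b = beta' x (fat_projection a * b).
have balancedD a c : balanced a -> balanced c -> balanced (a + c).
  by move=> ba bc x b; rewrite scalerDl b'D1 ba bc rmorphD -b'D2 -mulrDl.
have balancedM a c : balanced a -> balanced c -> balanced (a * c).
  move=> ba bc x b; rewrite -scalerA ba bc rmorphM mulrA.
  by congr (beta' x (_ * b)); exact: mulrC.
have balanced0 : balanced 0 by move=> x b; rewrite scale0r rmorph0 mul0r b'0 b'0l.
have balanced_proj f : balanced (fat_proj S k f).
  move=> x b; rewrite fat_projection_proj /beta' fat_coef0M fat_coef0_proj.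
  congr (_ + _); first exact: bZ.
  apply: eq_bigr => j _; rewrite scalerA mulrC -scalerA fat_coef1M fat_coef1_proj.
  by rewrite mul0r add0r fat_coef0_proj; exact: bZ.
have balanced_eps l : balanced (fat_eps S l).
  move=> x b; rewrite fat_projection_eps /beta' fat_coef0M fat_coef0_eps mul0r b0 add0r.
  rewrite big1 => [|j _]; last by rewrite scalerA fat_epsM scale0r b0l.
  rewrite addr0 (bigD1 l) //= big1 => [|j jl].
    by rewrite addr0 fat_coef1M fat_coef0_eps mul0r addr0 fat_coef1_eps eqxx mul1r.
  by rewrite fat_coef1M fat_coef0_eps mul0r addr0 fat_coef1_eps (negPf jl) mul0r b0.
exists beta'; split=> [|||x b].
- exact: b'D1.
- exact: b'D2.
- move=> a; rewrite (fat_decomp a); apply: (balancedD); first exact: (balanced_proj).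
  apply: (big_ind balanced) => [|a1 a2|j _]; [exact: balanced0|exact: balancedD|].
  by apply: balancedM; [exact: balanced_proj|exact: balanced_eps].
rewrite /beta' fat_coef0_proj big1 ?addr0 // => j _.
by rewrite fat_coef1_proj b0.
Qed.

Definition fat_inclusion : mor X Y :=
  fat_pair (z := fun _ : 'I_k => 0) (inclusion pi) (fun _ _ => mul0r _).

Lemma fat_inclusion_elem F : fat_inclusion F = inclusion pi (fat_coef0 F).
Proof.
rewrite [in LHS](fat_decomp F) fat_pair_elem big1 ?addr0 // => j _.
exact: mulr0.
Qed.

Lemma fat_inclusion_surj f : exists F, fat_inclusion F = f.
Proof.
have [F <-] := inclusion_surj pi f.
by exists (fat_proj E k F); rewrite fat_inclusion_elem fat_coef0_proj.
Qed.

Lemma fat_inclusion_ker F :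
  fat_inclusion F = 0 <-> ideal_span (fat_projection @` @gmax R B) F.
Proof.
split=> [|]; last first.
  apply: ideal_span_ker => _ [f f0 <-] /=.
  rewrite fat_inclusion_elem fat_coef0_projection inclusion_projection gval_fat_coef0.
  by move: f0; rewrite /gmax /= => ->; rewrite scale0r.
rewrite fat_inclusion_elem => /inclusion_ker F0.
rewrite (fat_decomp F); apply: ideal_spanD.
  apply: (ideal_span_morph (h := fat_proj E k)) F0 => _ [f f0 <-].
  apply: ideal_span_gen; exists (fat_proj S k f); first exact: pull_local.
  exact: fat_projection_proj.
(* The e_j lie in the maximal ideal of the base because they square to zero. *)
apply: ideal_span_sum => j; apply/ideal_spanM/ideal_span_gen.
exists (fat_eps S j); last exact: fat_projection_eps.
exact/gval_sq0/fat_epsM.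
Qed.

Definition fat_deformation : deformation X B :=
  Deformation fat_projection_flat fat_inclusion_surj fat_inclusion_ker.

Lemma fat_deformation_pullback : pullback_via fat_deformation (fat_proj S k) pi (fat_proj E k).
Proof.
split; last by move=> F; rewrite [LHS]fat_inclusion_elem fat_coef0_proj.
split=> [f|Z a b ab]; first exact/esym/fat_projection_proj.
(* The e_j are functions of the base, so b dictates their images on Z. *)
have zM i j : b (fat_eps S i) * b (fat_eps S j) = 0 by rewrite -rmorphM fat_epsM rmorph0.
exists (fat_pair a zM); split=> [f||c c_proj c_b].
- exact: fat_pair_proj.
- apply: (fat_mor_ext (c := mor_comp fat_projection (fat_pair a zM))) => [f|j] /=.
    by rewrite fat_projection_proj fat_pair_proj.
  by rewrite fat_projection_eps fat_pair_eps.
apply: fat_mor_ext => [f|j]; first by rewrite c_proj fat_pair_proj.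
by rewrite -fat_projection_eps [LHS]c_b fat_projection_eps fat_pair_eps.
Qed.

End FatProductDeformation.

(* The graph of phi embeds the fat point in its product with S. *)
Lemma fat_pullback_exists (R : realType) (X S : germ R) (k : nat) (pi : deformation X S)
    (phi : mor (fat_point R k) S) :
  exists rho : deformation X (fat_point R k), is_pullback rho phi pi.
Proof.
pose graph := fat_pair phi (@epsM R k).
have graph_surj t : exists s, graph s = t.
  (* The constants and the [eps] span the functions of the fat point, so a lift with constant
     coefficients suffices. *)
  exists (fat_elem (gval t)%:A (fun i => (fat_tangent R i t)%:A)).
  rewrite fat_pair_elem linearZ /= rmorph1 [RHS]fat_point_decomp; congr (_ + _).
  by apply: eq_bigr => i _; rewrite linearZ /= rmorph1 mulr_algl.
have [rho rho_graph] := closed_pullback_exists (fat_deformation pi k) graph_surj.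
exists rho; apply: (is_pullback_comp (phi := fat_proj S k) (psi := graph)) rho_graph.
  exact: fat_pair_proj.
by exists (fat_proj (total_space pi) k); exact: fat_deformation_pullback.
Qed.

(** * The Kodaira-Spencer map and invariants *)

Section KodairaSpencer.
Variables (R : realType) (X S : germ R) (pi : deformation X S).
Local Notation C := (R[i]).
Local Notation D := (double_point R).

Definition point_mor (w : tangent S) : mor D S := tangent_mor (fun _ : 'I_1 => w).

Lemma fat_tangent_mor k (Y : germ R) (u : 'I_k -> tangent Y) i f :
  fat_tangent R i (tangent_mor u f) = u i f.
Proof.
rewrite tangent_morE tangentD tangentZ tangent1 mulr0 add0r tangent_sum (bigD1 i) // big1.
  by apply: etrans (addr0 _) _; rewrite tangentZ fat_tangent_eps eqxx mulr1.
by move=> j /negPf ji; rewrite tangentZ fat_tangent_eps ji mulr0.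
Qed.

Lemma double_point_decomp (f : gfun D) :
  f = (gval f)%:A + fat_tangent R ord0 f *: eps R ord0.
Proof. by rewrite [LHS]fat_point_decomp big_ord1. Qed.

Lemma point_morE w f : point_mor w f = (gval f)%:A + w f *: eps R ord0.
Proof. by rewrite [LHS]tangent_morE big_ord1. Qed.

Definition kodaira_spencer_family (w : tangent S) : deformation X D :=
  sval (cid (fat_pullback_exists pi (point_mor w))).

Lemma kodaira_spencer_familyP w : is_pullback (kodaira_spencer_family w) (point_mor w) pi.
Proof. exact: (svalP (cid (fat_pullback_exists pi (point_mor w)))). Qed.

Definition kodaira_spencer (w : tangent S) : T1 X := T1_class (kodaira_spencer_family w).

(** Pull-backs along the same morphism are isomorphic, so the class does not depend on the family
    chosen. *)
Lemma kodaira_spencerP w xi :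
  T1_class xi = kodaira_spencer w <-> is_pullback xi (point_mor w) pi.
Proof.
rewrite T1_class_eq; split=> [xiw|xipi].
  exact: is_pullback_isol xiw (kodaira_spencer_familyP w).
exact: is_pullback_iso xipi (kodaira_spencer_familyP w).
Qed.

(** The pair (v, w) is a morphism to S from the fat point with two parameters; the pull-back along
    it restricts on the axes and the diagonal to the families of v, w and v + w. Scaling is the
    reparametrisation e -> c e of the double point. *)
Lemma kodaira_spencer_linear : T1_linear kodaira_spencer.
Proof.
split=> [v w|c v].
  pose u (j : 'I_2) := if j == ord0 then v else w.
  have [zeta zetapi] := fat_pullback_exists pi (tangent_mor u).
  (* The direction d followed by [tangent_mor u] is [point_mor x], so cancellation presents the
     family of x as a pull-back of [zeta]. *)
  have pull_dir (d : tangent (fat_point R 2)) (x : tangent S) :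
      (forall f, d (tangent_mor u f) = x f) ->
      is_pullback (kodaira_spencer_family x) (tangent_mor (fun _ : 'I_1 => d)) zeta.
    move=> dx; apply: is_pullback_cancel zetapi (kodaira_spencer_familyP x) => f.
    by rewrite [LHS]tangent_morE [RHS]tangent_morE !big_ord1 dx gval_pull.
  have dir_eps (d : tangent (fat_point R 2)) j :
      tangent_mor (fun _ : 'I_1 => d) (eps R j) = d (eps R j) *: eps R ord0.
    by rewrite tangent_morE gval_eps scale0r add0r big_ord1.
  exists zeta, (tangent_mor (fun=> fat_tangent R ord0)),
    (tangent_mor (fun=> fat_tangent R ord_max)),
    (tangent_mor (fun=> fat_tangent R ord0 + fat_tangent R ord_max)),
    (kodaira_spencer_family v), (kodaira_spencer_family w), (kodaira_spencer_family (v + w)).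
  have addE (Y : germ R) (x y : tangent Y) f : (x + y) f = x f + y f by [].
  split=> //.
  - by rewrite !dir_eps !fat_tangent_eps /= scale1r scale0r.
  - by rewrite !dir_eps !fat_tangent_eps /= scale1r scale0r.
  - by rewrite !dir_eps !addE !fat_tangent_eps /= addr0 add0r scale1r.
  split; apply: pull_dir => f; rewrite ?addE !fat_tangent_mor //.
exists (tangent_mor (fun=> c *: fat_tangent R ord0)), (kodaira_spencer_family v),
  (kodaira_spencer_family (c *: v)).
have scaleE (Y : germ R) (x : tangent Y) f : (c *: x) f = c * x f by [].
split=> //.
  by rewrite tangent_morE gval_eps scale0r add0r big_ord1 scaleE fat_tangent_eps mulr1.
apply: is_pullback_cancel (kodaira_spencer_familyP v) (kodaira_spencer_familyP _) => f.
by rewrite [LHS]tangent_morE [RHS]tangent_morE !big_ord1 !scaleE fat_tangent_mor gval_pull.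
Qed.

Lemma semiuniversal_pullback_uniq T (rho : deformation X T) (phi psi : mor T S) :
  semiuniversal pi -> is_pullback rho phi pi -> is_pullback rho psi pi -> same_differential phi psi.
Proof.
move=> /(_ T rho)[chi [_ uniq]] /uniq phichi /uniq psichi v.
by rewrite phichi psichi.
Qed.

Lemma kodaira_spencer_inj : semiuniversal pi -> injective kodaira_spencer.
Proof.
move=> semi v w /kodaira_spencerP vw; apply/val_inj/funext => f.
(* The vector dual to e is sent to v by the differential of [point_mor v] and to w by that of
   [point_mor w]. *)
have same := semiuniversal_pullback_uniq semi (kodaira_spencer_familyP v) vw (fat_tangent R ord0).
have : fat_tangent R ord0 (point_mor v f) = fat_tangent R ord0 (point_mor w f).
  exact: (congr1 (fun x : tangent S => x f) same).
by rewrite !fat_tangent_mor.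
Qed.

End KodairaSpencer.

(** * Restriction to the fixed germ *)

Section Fixed.
Variables (R : realType) (G : complexLieGroup R) (X : germ R) (aX : action G X).
Variables (S : germ R) (aS : action G S) (eta : equivariant_deformation aX aS).
Local Notation SG := (fixed_germ aS).
Local Notation D := (double_point R).

Definition fixed_incl : mor SG S :=
  @subgerm_incl R S [set h | exists g f, h = aS g f - f] (@fixed_gens_at0 R G S aS).

Lemma fixed_incl_surj t : exists s, fixed_incl s = t.
Proof. exact: subgerm_incl_surj. Qed.

Lemma fixed_incl_act g f : fixed_incl (aS g f) = fixed_incl f.
Proof.
apply/eqP; rewrite -subr_eq0 -rmorphB; apply/eqP/subgerm_incl_ker/ideal_span_gen.
by exists g, f.
Qed.

(** The ideal of S^G is generated by the differences [aS g h - h], which an invariant [phi]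
    kills. *)
Lemma fixed_incl_factor (T : germ R) (phi : mor T S) : (forall g f, phi (aS g f) = phi f) ->
  exists phi' : mor T SG, forall f, phi' (fixed_incl f) = phi f.
Proof.
move=> phi_inv; apply: (mor_factor fixed_incl_surj) => f /subgerm_incl_ker.
by apply: ideal_span_ker => _ [g [h ->]]; rewrite rmorphB /= phi_inv subrr.
Qed.

Lemma fixed_differential_inj : injective (differential fixed_incl).
Proof.
move=> v w vw; apply/val_inj/funext => t; have [s <-] := fixed_incl_surj t.
exact: (congr1 (fun x : tangent S => x s) vw).
Qed.

(** The action of g on the total space covers that on S and extends that on X; composing [Phi] with
    it cancels the g^-1 in the new identification. *)
Lemma twist_pullback (g : G) (T : germ R) (xi : deformation X T) (phi : mor T S) :
  is_pullback xi phi eta -> is_pullback (twist aX g xi) (mor_comp (aS g) phi) eta.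
Proof.
move=> [Phi [[sq univ] inc]]; exists (mor_comp (total_action eta g) Phi); split; last first.
  by move=> F /=; rewrite inc inclusion_equivariant actKV.
split=> [f|Z a b ab] /=; first by rewrite projection_equivariant sq.
(* The cone is moved back by g^-1 before the cartesian square of [Phi] is applied. *)
have [f|c [cPhi crho cuniq]] := univ Z (mor_comp (total_action eta g^-1%g) a) b.
  by rewrite /= projection_equivariant ab /= actVK.
exists c; split=> // [f|c' c'Phi c'rho f]; first by rewrite cPhi /= actKV.
by apply: cuniq => // F /=; rewrite -c'Phi actVK.
Qed.

(** The ideal of S^G is stable under G, hence so is the ideal it generates upstairs, and the action
    descends to the quotient. Since G acts trivially on S^G, the result is a deformation of the
    pair. *)
Lemma fixed_restriction_exists : exists (pi : pair_deformation aX SG)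
    (q : mor (total_space pi) (total_space eta)),
  [/\ pullback_via pi fixed_incl eta q, forall F, exists F', q F' = F &
      forall g F, total_action pi g (q F) = q (total_action eta g F)].
Proof.
pose J := projection eta @` [set f | fixed_incl f = 0].
have J0 (a : cps R (gdim (total_space eta))) : subgerm_gens J a -> a mpoly.mnm0 = 0.
  move=> [/gideal_at0//|[f f0 fa]].
  by rewrite -gval_class -fa gval_pull -(gval_pull fixed_incl) f0 gval0.
pose q := subgerm_incl J0.
have Jstable g f : J f -> ideal_span J (total_action eta g f).
  move=> [s s0 <-]; apply: ideal_span_gen; exists (aS g s).
    exact: etrans (fixed_incl_act g s) s0.
  by rewrite projection_equivariant.
have [act actE] := subgerm_action J0 Jstable.
pose rho := closed_pullback fixed_incl_surj
  (@subgerm_incl_surj _ _ _ J0) (@subgerm_incl_ker _ _ _ J0).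
have proj_eq g t : act g (projection rho t) = projection rho (trivial_action G SG g t).
  have [s <-] := fixed_incl_surj t.
  rewrite [projection rho _]closed_projectionE actE projection_equivariant.
  transitivity (projection rho (fixed_incl (aS g s))); first exact/esym/closed_projectionE.
  by rewrite fixed_incl_act; exact: closed_projectionE.
have incl_eq g F : inclusion rho (act g F) = aX g (inclusion rho F).
  have [F' <-] := @subgerm_incl_surj _ _ _ J0 F.
  by rewrite actE ![inclusion rho _]closed_inclusionE inclusion_equivariant.
exists (@EquivariantDeformation R G X aX SG (trivial_action G SG) rho act proj_eq incl_eq), q.
split.
- exact: closed_pullback_via.
- exact: subgerm_incl_surj.
exact: actE.
Qed.

(** For the trivial action on T, equivariance of the classifying morphism means invariance, so it
    factors through S^G. Uniqueness is inherited because tangent vectors of S^G are determined by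
    their images in S. *)
Lemma restriction_pair_semiuniversal (pi : pair_deformation aX SG)
    (q : mor (total_space pi) (total_space eta)) :
  equivariantly_semiuniversal eta ->
  pullback_via pi fixed_incl eta q -> (forall F, exists F', q F' = F) ->
  (forall g F, total_action pi g (q F) = q (total_action eta g F)) ->
  pair_semiuniversal pi.
Proof.
move=> [_ semi] pb_q q_surj q_equiv T rho.
have [phi [phi_equiv [Phi pb_Phi Phi_equiv] phi_uniq]] := semi T (trivial_action G T) rho.
have [phi' phi'E] := fixed_incl_factor phi_equiv.
exists phi'; split=> [|psi [Psi pb_Psi Psi_equiv] v].
  have [|Psi pb_Psi PsiE] := pullback_cancel (psi := phi') (Chi := Phi) pb_q.
    by apply: eq_pullback_via pb_Phi => f; exact/esym/phi'E.
  (* Equivariance is checked on the image of [q], which is everything; there it is that of [Phi]. *)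
  exists Psi => // g F; have [F' <-] := q_surj F.
  by rewrite q_equiv !PsiE Phi_equiv.
have same : same_differential (mor_comp fixed_incl psi) phi.
  apply: phi_uniq => [g f|]; first exact: (congr1 psi (fixed_incl_act g f)).
  exists (mor_comp q Psi); first exact: pullback_comp.
  by move=> g F; rewrite /= -q_equiv Psi_equiv.
apply/val_inj/funext => t; have [s <-] := fixed_incl_surj t.
have vs := congr1 (fun x : tangent S => x s) (same v).
exact: etrans vs (congr1 v (esym (phi'E s))).
Qed.

Lemma kodaira_spencer_invariant (x : T1 X) : semiuniversal eta ->
  T1_invariant aX x <-> exists v, kodaira_spencer eta (differential fixed_incl v) = x.
Proof.
move=> semi; split=> [xinv|[v <-] g xi xiv].
  have [xi xE] := T1_classP x; have [phi [xiphi _]] := semi _ xi.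
  have phi_inv g f : phi (aS g f) = phi f.
    (* Invariance makes [xi] isomorphic to its twist, hence also a pull-back along g composed with
       [phi]; uniqueness of the differential compares the two morphisms. *)
    have xitwist : is_pullback xi (mor_comp (aS g) phi) eta.
      apply: is_pullback_isol (twist_pullback g xiphi).
      by apply/T1_class_eq; rewrite (xinv g xi xE).
    have := semiuniversal_pullback_uniq semi xitwist xiphi (fat_tangent R ord0).
    move=> /(congr1 (fun w : tangent S => w f)) /= e.
    (* A morphism from the double point is determined by its differential, the value at 0 being
       preserved. *)
    by rewrite (double_point_decomp (phi f)) [LHS]double_point_decomp !gval_pull [X in _ + X *: _]e.
  have [phi' phi'E] := fixed_incl_factor phi_inv.
  exists (differential phi' (fat_tangent R ord0)).
  rewrite xE; apply/esym/kodaira_spencerP; apply: eq_is_pullback xiphi => f.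
  rewrite point_morE [LHS]double_point_decomp gval_pull; congr (_ + _ *: _).
  exact: (congr1 (fat_tangent R ord0) (esym (phi'E f))).
(* Conversely, g does not move the morphism given by a tangent vector of S^G, so the twist is a
   pull-back along the same morphism. *)
apply/kodaira_spencerP.
have /kodaira_spencerP/(twist_pullback g) := esym xiv.
apply: eq_is_pullback => f.
rewrite [RHS]point_morE; apply: etrans (point_morE _ (aS g f)) _; rewrite gval_pull.
by congr (_ + _ *: _); exact: (congr1 v (fixed_incl_act g f)).
Qed.

End Fixed.

Theorem theorem2p6 (R : realType) (G : complexLieGroup R)
    (G_compact : compact [set: G])
    (X : germ R) (T1_findim : T1_finite_dim X) (aX : action G X)
    (S : germ R) (aS : action G S) (eta : equivariant_deformation aX aS)
    (eta_semiuniversal : equivariantly_semiuniversal eta) :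
  exists pi : pair_deformation aX (fixed_germ aS),
    pair_semiuniversal pi /\
    exists theta : tangent (fixed_germ aS) -> T1 X,
      [/\ T1_linear theta, injective theta &
          forall x : T1 X, T1_invariant aX x <-> exists v, theta v = x].
Proof.
have [pi [q [pb_q q_surj q_equiv]]] := fixed_restriction_exists eta.
exists pi; split; first exact: restriction_pair_semiuniversal eta_semiuniversal pb_q _ _.
have [semi _] := eta_semiuniversal.
(* The Kodaira-Spencer map of [eta] restricted to T_0 S^G inside T_0 S. *)
exists (kodaira_spencer eta \o differential (fixed_incl aS)); split.
- have [addKS scaleKS] := kodaira_spencer_linear eta; split=> [v w|c v] /=.
    have -> : differential (fixed_incl aS) (v + w) =
      differential (fixed_incl aS) v + differential (fixed_incl aS) w by exact: val_inj.
    exact: addKS.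
  have -> : differential (fixed_incl aS) (c *: v) = c *: differential (fixed_incl aS) v.
    exact: val_inj.
  exact: scaleKS.
- by move=> v w /(kodaira_spencer_inj semi)/fixed_differential_inj.
by move=> x; exact: kodaira_spencer_invariant.
Qed.
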